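(* Fix $r\in(0,\infty)$. Let $(s_n)$ be a sequence of integers with $1\le s_n\le n$ and $(t_n)$ a sequence of positive reals. Suppose that, as $n\to\infty$, $\eta_n=s_n/n\to0$, $t_n/(\log\eta_n^{-1})^{1/2}\to\infty$, and $\log t_n/(\log\eta_n^{-1})\to0$. Let $\hat p_{\mathsf S}[t_n]$ be the Bayes predictive density estimate based on the product spike-and-slab prior $\prod_{i=1}^n\pi_{\mathsf S}[\eta_n,t_n](d\theta_i)$. Then $$\lim_{n\to\infty}\Bigl\{\max_{\boldsymbol\theta\in\Theta_n[s_n,t_n]}\rho(\boldsymbol\theta,\hat p_{\mathsf S}[t_n])\Bigr\}\Big/R_N(\Theta_n[s_n,t_n])=1.$$
   Context: Model: $\boldsymbol X\sim N_n(\boldsymbol\theta,\boldsymbol I)$ and $\boldsymbol Y\sim N_n(\boldsymbol\theta,r\boldsymbol I)$ are independent given the unknown $\boldsymbol\theta\in\mathbb R^n$; $r>0$ is known and fixed. Let $p(\boldsymbol x|\boldsymbol\theta,1)$ and $p(\boldsymbol y|\boldsymbol\theta,r)$ denote the Gaussian densities of $\boldsymbol X$ and $\boldsymbol Y$. A predictive density estimator $\hat p(\boldsymbol y|\boldsymbol x)$ is, for each $\boldsymbol x\in\mathbb R^n$, a probability density in $\boldsymbol y\in\mathbb R^n$ (jointly measurable). Its Kullback–Leibler loss is $L(\boldsymbol\theta,\hat p(\cdot|\boldsymbol x))=\int p(\boldsymbol y|\boldsymbol\theta,r)\log\frac{p(\boldsymbol y|\boldsymbol\theta,r)}{\hat p(\boldsymbol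 y|\boldsymbol x)}\,d\boldsymbol y$ and its risk is $\rho(\boldsymbol\theta,\hat p)=\int L(\boldsymbol\theta,\hat p(\cdot|\boldsymbol x))\,p(\boldsymbol x|\boldsymbol\theta,1)\,d\boldsymbol x$. For a prior $\pi$ on $\mathbb R^n$ the Bayes predictive density estimate is $\hat p_\pi(\boldsymbol y|\boldsymbol x)=\int p(\boldsymbol y|\boldsymbol\theta,r)\,\pi(d\boldsymbol\theta|\boldsymbol x)$, with $\pi(d\boldsymbol\theta|\boldsymbol x)$ the posterior given $\boldsymbol X=\boldsymbol x$. Let $\|\boldsymbol\theta\|_0=\#\{i:\theta_i\ne0\}$, $\Theta_n[s,t]=\{\boldsymbol\theta\in\mathbb R^n:\|\boldsymbol\theta\|_0\le s\text{ and }|\theta_i|\le t\text{ for all }i=1,\dots,n\}$, and $R_N(\Theta)=\inf_{\hat p}\sup_{\boldsymbol\theta\in\Theta}\rho(\boldsymbol\theta,\hat p)$, the infimum being over all predictive density estimators. ''$\max$'' denotes supremum. Spike-and-slab prior: $\pi_{\mathsf S}[\eta,l](d\mu)=(1-\eta)\delta_0(d\mu)+\frac{\eta}{2l}\,\mathbf 1\{\mu\in[-l,l]\}\,d\mu$ for $l>0$, where $\delta_0$ is the unit point mass at $0$. *)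

(* Defs.v *)
From HB Require Import structures.
From mathcomp Require Import all_boot all_order all_algebra.
From mathcomp Require Import all_classical all_reals all_analysis.
From mathcomp Require Import measurable_realfun.

Set Implicit Arguments.
Unset Strict Implicit.
Unset Printing Implicit Defensive.

Import Order.TTheory GRing.Theory Num.Theory.
Import numFieldNormedType.Exports.

Local Open Scope classical_set_scope.
Local Open Scope ring_scope.

Section cons_measure.
Context d (T : measurableType d) (R : realType) (n : nat).

Definition tuple_cons (z : T * n.-tuple T) : n.+1.-tuple T :=
  [tuple of z.1 :: z.2].

Lemma measurable_tuple_cons : measurable_fun [set: T * n.-tuple T] tuple_cons.
Proof. exact: (measurable_cons measurable_fst measurable_snd). Qed.

Definition cons_measure (m1 : set T -> \bar R)
    (m2 : set (n.-tuple T) -> \bar R) : set (n.+1.-tuple T) -> \bar R :=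
  pushforward (m1 \x m2)%E tuple_cons.

Variables (m1 : {sigma_finite_measure set T -> \bar R}).
Variables (m2 : {sigma_finite_measure set (n.-tuple T) -> \bar R}).

Let mtc := measurable_tuple_cons.

Let cons_measure0 : cons_measure m1 m2 set0 = 0%E.
Proof. by rewrite /cons_measure /pushforward preimage_set0 measure0. Qed.

Let cons_measure_ge0 A : (0 <= cons_measure m1 m2 A)%E.
Proof. exact: measure_ge0. Qed.

Let cons_measure_sigma_additive : semi_sigma_additive (cons_measure m1 m2).
Proof. exact: measure_semi_sigma_additive. Qed.

HB.instance Definition _ := isMeasure.Build _ _ _ (cons_measure m1 m2)
  cons_measure0 cons_measure_ge0 cons_measure_sigma_additive.

Let cons_measure_sigma_finite : sigma_finite setT (cons_measure m1 m2).
Proof.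
have /sigma_finiteP[F [FT ndF Foo]] := sigma_finiteT m1.
have /sigma_finiteP[G [GT ndG Goo]] := sigma_finiteT m2.
pose uncons (v : n.+1.-tuple T) : T * n.-tuple T :=
  (thead v, [tuple of behead v]).
have tcK : cancel tuple_cons uncons.
  move=> [x v]; rewrite /uncons /tuple_cons /=; congr pair.
  exact/val_inj.
have munc : measurable_fun setT uncons.
  apply/measurable_fun_pairP; split; first exact: measurable_tnth.
  exact: measurable_behead.
have FGT : \bigcup_k (F k `*` G k) = setT.
  rewrite -setXTT FT GT predeqE => -[x y]; split.
    by move=> [k _ []/= ? ?]; split; exists k.
  move=> [/= [k _ Fkx] [l _ Gly]]; exists (maxn k l) => //; split.
  - by move: x Fkx; exact/subsetPset/ndF/leq_maxl.
  - by move: y Gly; exact/subsetPset/ndG/leq_maxr.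
exists (fun k => uncons @^-1` (F k `*` G k)).
  by rewrite -preimage_bigcup FGT preimage_setT.
move=> k; have [? ?] := Foo k; have [? ?] := Goo k; split.
  by rewrite -[X in measurable X]setTI; apply: munc => //; exact: measurableX.
rewrite /cons_measure /pushforward -comp_preimage.
rewrite (_ : uncons \o tuple_cons = id); last exact/funext.
by rewrite preimage_id product_measure1E// lte_mul_pinfty// ge0_fin_numE.
Qed.

HB.instance Definition _ := Measure_isSigmaFinite.Build _ _ _
  (cons_measure m1 m2) cons_measure_sigma_finite.

End cons_measure.

Section power_measure.
Context d (T : measurableType d) (R : realType).

(* The n-fold product measure of [mu] on [n.-tuple T]. *)
Fixpoint power_measure (mu : set T -> \bar R) (n : nat) :
    set (n.-tuple T) -> \bar R :=
  match n with
  | 0 => \d_[tuple]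
  | n'.+1 => cons_measure mu (@power_measure mu n')
  end.

End power_measure.
Arguments power_measure {d T R} mu n.

Section power_measure_sigma_finite.
Context d (T : measurableType d) (R : realType).
Variable mu : {sigma_finite_measure set T -> \bar R}.

Let bundle n : {m : {sigma_finite_measure set (n.-tuple T) -> \bar R} |
  power_measure mu n = m}.
Proof.
elim: n => [|n [m IH]] /=.
  by exists (dirac ([tuple] : 0.-tuple T)).
by rewrite IH; exists (cons_measure mu m).
Qed.

Variable n : nat.

Let power_measure0 : power_measure mu n set0 = 0%E.
Proof. by have [m ->] := bundle n; rewrite measure0. Qed.

Let power_measure_ge0 A : (0 <= power_measure mu n A)%E.
Proof. by have [m ->] := bundle n. Qed.

Let power_measure_sigma_additive :
  semi_sigma_additive (power_measure mu n).
Proof. by have [m ->] := bundle n; exact: measure_semi_sigma_additive. Qed.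

HB.instance Definition _ := isMeasure.Build _ _ _ (power_measure mu n)
  power_measure0 power_measure_ge0 power_measure_sigma_additive.

Let power_measure_sigma_finite :
  sigma_finite setT (power_measure mu n).
Proof. by have [m ->] := bundle n; exact: sigma_finiteT. Qed.

HB.instance Definition _ := Measure_isSigmaFinite.Build _ _ _
  (power_measure mu n) power_measure_sigma_finite.

End power_measure_sigma_finite.

Section power_measure_probability.
Context d (T : measurableType d) (R : realType).
Variables (P : probability T R) (n : nat).

Let power_measure_setT : power_measure P n setT = 1%E.
Proof.
elim: n => [|m IH] /=; first by rewrite diracT.
rewrite /cons_measure /pushforward preimage_setT -setXTT.
transitivity (P setT * power_measure P m setT)%E.
  exact: product_measure1E.
by rewrite [X in (_ * X)%E]IH [X in (X * _)%E]probability_setT mule1.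
Qed.

HB.instance Definition _ := Measure_isProbability.Build _ _ _
  (power_measure P n) power_measure_setT.

End power_measure_probability.

(* R^n with its Borel sigma-algebra; [measurableTypeR R] is the copy of [R] on
   which the library defines [lebesgue_measure]. *)
Notation vec R n := (n.-tuple (measurableTypeR R)).

Definition lebesgue_vec (R : realType) (n : nat) : set (vec R n) -> \bar R :=
  power_measure (@lebesgue_measure R) n.
Arguments lebesgue_vec : clear implicits.

HB.instance Definition _ (R : realType) (n : nat) :=
  SigmaFiniteMeasure.on (lebesgue_vec R n).

Section gaussian.
Context {R : realType} {n : nat}.
Implicit Types (th x y : vec R n) (v : R).

(* Density at [y] of N_n(th, v I); [normal_pdf] takes a standard deviation. *)
Definition gaussian_pdf th v y : R :=
  \prod_(i < n) normal_pdf (tnth th i) (Num.sqrt v) (tnth y i).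

Lemma gaussian_pdf_ge0 th v y : 0 <= gaussian_pdf th v y.
Proof. by apply: prodr_ge0 => i _; exact: normal_pdf_ge0. Qed.

Lemma measurable_gaussian_pdf th v : measurable_fun setT (gaussian_pdf th v).
Proof.
apply: measurable_prod => i _.
apply: (measurableT_comp (measurable_normal_pdf _ _)).
exact: measurable_tnth.
Qed.

Lemma gaussian_pdfC th v y : 0 < v -> gaussian_pdf th v y = gaussian_pdf y v th.
Proof.
move=> v0; apply: eq_bigr => i _; rewrite !normal_pdfE ?gt_eqF ?sqrtr_gt0//.
by rewrite /normal_fun -sqrrN opprB.
Qed.

End gaussian.

Section kullback_leibler.
Context {R : realType} {n : nat}.
Implicit Types (th x : vec R n) (q : vec R n -> vec R n -> R).
Local Open Scope ereal_scope.

Definition predictive_density q :=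
  [/\ measurable_fun [set: vec R n * vec R n] (fun z => q z.1 z.2),
      forall x y, (0 <= q x y)%R
    & forall x, \int[lebesgue_vec R n]_y (q x y)%:E = 1].

(* The quotient and the logarithm are those of [\bar R], so that the loss is
   infinite if [q0] vanishes on a set of positive measure. *)
Definition kl_loss (r : R) th (q0 : vec R n -> R) : \bar R :=
  \int[lebesgue_vec R n]_y
    ((gaussian_pdf th r y)%:E * lne ((gaussian_pdf th r y)%:E / (q0 y)%:E)).

Definition risk (r : R) th q : \bar R :=
  \int[lebesgue_vec R n]_x (kl_loss r th (q x) * (gaussian_pdf th 1 x)%:E).

Definition max_risk (r : R) (Theta : set (vec R n)) q : \bar R :=
  ereal_sup [set risk r th q | th in Theta].

Definition minimax_risk (r : R) (Theta : set (vec R n)) : \bar R :=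
  ereal_inf [set max_risk r Theta q | q in predictive_density].

End kullback_leibler.

Definition sparse_box (R : realType) (n s : nat) (t : R) : set (vec R n) :=
  [set th | (#|[pred i | (tnth th i : R) != 0%R]| <= s)%N /\
            forall i, `|tnth th i : R| <= t].

Arguments sparse_box {R} n s t.

Section bayes.
Context {R : realType} {n : nat} (P : probability (vec R n) R).
Implicit Types x y : vec R n.

Definition joint_measure x : set (vec R n) -> \bar R :=
  fun A => (\int[P]_(th in A) (gaussian_pdf th 1 x)%:E)%E.

Section joint_measure.
Variable x : vec R n.

Let joint_measure0 : joint_measure x set0 = 0%E.
Proof. exact: integral_set0. Qed.

Let joint_measure_ge0 A : (0 <= joint_measure x A)%E.
Proof. by apply: integral_ge0 => th _; rewrite lee_fin gaussian_pdf_ge0. Qed.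

Let joint_measure_sigma_additive : semi_sigma_additive (joint_measure x).
Proof.
move=> F mF tF mUF; rewrite /joint_measure; apply: cvg_toP.
  apply: ereal_nondecreasing_is_cvgn => m k mk.
  by apply: lee_sum_nneg_natr => // *; exact: joint_measure_ge0.
rewrite ge0_integral_bigcup//=.
- have -> : (fun th => (gaussian_pdf th 1 x)%:E) = EFin \o gaussian_pdf x 1.
    by apply/funext => th /=; rewrite gaussian_pdfC.
  apply/measurable_EFinP; apply: measurable_funS (measurable_gaussian_pdf _ _).
  - exact: measurableT.
  - exact: subsetT.
- by move=> th _; rewrite lee_fin gaussian_pdf_ge0.
Qed.

HB.instance Definition _ := isMeasure.Build _ _ _ (joint_measure x)
  joint_measure0 joint_measure_ge0 joint_measure_sigma_additive.

End joint_measure.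

(* The second argument of [mnormalize] is a default value for a measure of
   mass 0 or +oo; the mass of [joint_measure x] is the marginal density of X
   at [x], which is positive and finite. *)
Definition posterior x : set (vec R n) -> \bar R :=
  mnormalize (joint_measure x) P.

HB.instance Definition _ x := Probability.on (posterior x).

Definition bayes_predictive (r : R) x y : R :=
  \int[posterior x]_th gaussian_pdf th r y.

End bayes.

Section spike_slab.
Context {R : realType} (eta l : R).

(* As for the distributions of the library, a default probability measure is
   used when the parameters are out of range. *)
Definition spike_slab : set (measurableTypeR R) -> \bar R := fun A =>
  if (0 <= eta <= 1) && (0 < l) then
    ((1 - eta)%:E * \d_(0%R : measurableTypeR R) A +
      (eta / (2 * l))%:E * lebesgue_measure (A `&` `[(- l)%R, l]))%E
  else \d_(0%R : measurableTypeR R) A.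

Let bundle : {m : {measure set (measurableTypeR R) -> \bar R} | spike_slab = m}.
Proof.
have [c|/negbTE c] := boolP ((0 <= eta <= 1) && (0 < l)); last first.
  exists (dirac (0%R : measurableTypeR R)).
  by apply/funext => A; rewrite /spike_slab c.
have /andP[/andP[eta0 eta1] l0] := c.
have e1 : 0 <= 1 - eta by rewrite subr_ge0.
have e2 : 0 <= eta / (2 * l) by rewrite divr_ge0// mulr_ge0// ltW.
have mI : measurable (`[- l, l]%classic : set (measurableTypeR R)).
  exact: measurable_itv.
exists (measure_add (mscale (NngNum e1) (dirac (0%R : measurableTypeR R)))
  (mscale (NngNum e2) (mrestr lebesgue_measure mI))).
by apply/funext => A; rewrite [RHS]measure_addE /spike_slab c.
Qed.

Let spike_slab0 : spike_slab set0 = 0%E.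
Proof. by have [m ->] := bundle; rewrite measure0. Qed.

Let spike_slab_ge0 A : (0 <= spike_slab A)%E.
Proof. by have [m ->] := bundle. Qed.

Let spike_slab_sigma_additive : semi_sigma_additive spike_slab.
Proof. by have [m ->] := bundle; exact: measure_semi_sigma_additive. Qed.

HB.instance Definition _ := isMeasure.Build _ _ _ spike_slab
  spike_slab0 spike_slab_ge0 spike_slab_sigma_additive.

Let spike_slab_setT : spike_slab setT = 1%E.
Proof.
rewrite /spike_slab; case: ifPn => [/andP[_ l0]|_]; last by rewrite diracT.
rewrite diracT mule1 setTI lebesgue_measure_itv/= lte_fin gtrN// -EFinD.
have -> : l - - l = 2 * l by rewrite opprK mulr_natl mulr2n.
by rewrite divfK ?subrK// mulf_neq0 ?gt_eqF// pnatr_eq0.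
Qed.

HB.instance Definition _ := Measure_isProbability.Build _ _ _
  spike_slab spike_slab_setT.

End spike_slab.

Definition spike_slab_predictive (R : realType) (n : nat) (r eta l : R) :
    vec R n -> vec R n -> R :=
  bayes_predictive (power_measure (spike_slab eta l) n) r.
Arguments spike_slab_predictive {R n} r eta l.

(* Main.v *)
(** Both sides are asymptotic to [s L / (1 + r)] with [L = ln (n / s)].

    Upper bound: under the product prior the predictive density is a product
    of ratios [m2 (x_i, y_i) / m1 (x_i)] of univariate marginals, so the loss is
    a sum over coordinates. A zero coordinate costs at most [2 eta] because the
    spike keeps mass [1 - eta]. For a coordinate [th <> 0], bounding [m2] below
    by the spike costs [th ^ 2 / (2 r)], while bounding it below by the slab
    costs [L + ln t] and gains back [th ^ 2 / 2] from [m1]; up to lower order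
    terms both are at most [L / (1 + r)] when split at
    [th ^ 2 / 2 = L r / (1 + r)].

    Lower bound: cut the coordinates into [s] blocks of length [m = n / s] and
    put one spike of height [lam] uniformly in each block, where
    [lam ^ 2 / 2 = r / (1 + r) ln m]. For an arbitrary [q], the inequality
    [ln u >= ln G + 1 - G / u], with [u] the ratio of [p_j (x) p_j (y)] to
    [p_0 (x) q (y | x)] and [G] the posterior-to-prior ratio of the [j]-th configuration,
    replaces the Bayes risk by the mean of [ln G]: the average over [j] of the
    expectations of [G / u] is 1. At this height [ln G] is about [s ln m], and
    [ln (p_j (x) / p_0 (x))] takes back about [s lam ^ 2 / 2]. *)
Require Import Defs.
From mathcomp Require Import all_boot all_order all_algebra.
From mathcomp Require Import all_classical all_reals all_analysis.
From mathcomp Require Import measurable_realfun.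
From mathcomp Require Import ring lra.
Set Implicit Arguments.
Unset Strict Implicit.
Unset Printing Implicit Defensive.
Import Order.TTheory GRing.Theory Num.Theory.
Import numFieldNormedType.Exports.
Local Open Scope classical_set_scope.
Local Open Scope ring_scope.

(** * Integration *)

Section integration.
Context d (T : measurableType d) (R : realType).
Implicit Types (mu : {measure set T -> \bar R}) (f g h : T -> \bar R).
Local Open Scope ereal_scope.

(* The library asks for measurability of the larger function as well. *)
Lemma ge0_le_integralT mu f g : (forall x, 0 <= f x) ->
  (forall x, f x <= g x) -> \int[mu]_x f x <= \int[mu]_x g x.
Proof.
move=> f0 fg; rewrite !ge0_integralTE//; last first.
  by move=> x; exact: le_trans (f0 x) (fg x).
by apply: le_ereal_sup => _ [h hf <-]; exists h => // x; exact: le_trans (fg x).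
Qed.

(** The order passes to positive parts and is reversed on negative parts. This form compares
    logarithmic losses whose integrals may be infinite. *)
Lemma le_integralT mu f g : (forall x, f x <= g x) ->
  \int[mu]_x f x <= \int[mu]_x g x.
Proof.
move=> fg; rewrite (integralE _ _ f) (integralE _ _ g); apply: leeB.
- apply: ge0_le_integralT => x; first exact: funepos_ge0.
  by rewrite !funeposE; exact: le_max2.
- apply: ge0_le_integralT => x; first exact: funeneg_ge0.
  by rewrite !funenegE; apply: le_max2 => //; rewrite leeN2.
Qed.

(** [g] is the integrable part of a bound, of any sign, and [h] a nonnegative error. Additivity
    needs [h] integrable; if its integral is infinite, the right-hand side is [+oo]. *)
Lemma le_integral_add mu f g h : mu.-integrable setT g ->
  measurable_fun setT h -> (forall x, 0 <= h x) ->
  (forall x, f x <= g x + h x) ->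
  \int[mu]_x f x <= \int[mu]_x g x + \int[mu]_x h x.
Proof.
move=> ig mh h0 fgh.
have gfin : \int[mu]_x g x \is a fin_num by exact: integrable_fin_num.
have [hoo|] := eqVneq (\int[mu]_x h x) +oo.
  by rewrite hoo addey ?leey//; case: (\int[mu]_x g x) gfin.
rewrite -ltey => hfin.
have ih : mu.-integrable setT h.
  by apply/integrableP; split => //; under eq_integral do rewrite gee0_abs//.
apply: le_trans (le_integralT _ fgh) _.
by rewrite integralD.
Qed.

Lemma ge_integral_sub mu f g h : mu.-integrable setT g ->
  measurable_fun setT h -> (forall x, 0 <= h x) ->
  (forall x, g x - h x <= f x) ->
  \int[mu]_x g x - \int[mu]_x h x <= \int[mu]_x f x.
Proof.
move=> ig mh h0 fgh.
have gfin : \int[mu]_x g x \is a fin_num by exact: integrable_fin_num.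
have [->|] := eqVneq (\int[mu]_x h x) +oo.
  by case: (\int[mu]_x g x) gfin => // *; exact: leNye.
rewrite -ltey => hfin.
have ih : mu.-integrable setT h.
  by apply/integrableP; split => //; under eq_integral do rewrite gee0_abs//.
apply: le_trans (le_integralT _ fgh).
by rewrite integralB.
Qed.

Import HBNNSimple.

(** Simple functions first, then monotone convergence. It serves for the posterior, whose density
    with respect to the prior is the normalized likelihood, and for the restriction of Lebesgue
    measure to the slab. *)
Lemma ge0_integral_density mu (nu : {measure set T -> \bar R}) (g : T -> R) f :
  measurable_fun setT g -> (forall x, 0 <= g x)%R ->
  (forall A, measurable A -> nu A = \int[mu]_(x in A) (g x)%:E) ->
  measurable_fun setT f -> (forall x, 0 <= f x) ->
  \int[nu]_x f x = \int[mu]_x (f x * (g x)%:E).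
Proof.
move=> mg g0 nuE mf f0.
have mgE : measurable_fun setT (EFin \o g) by exact/measurable_EFinP.
pose f_ := nnsfun_approx measurableT mf.
have nd x : nondecreasing_seq (fun n => f_ n x).
  by move=> a b ab; exact/lefP/nd_nnsfun_approx.
have sE (h : {nnsfun T >-> R}) :
    \int[nu]_x (h x)%:E = \int[mu]_x ((h x)%:E * (g x)%:E).
  under eq_integral do rewrite fimfunE -fsumEFin//.
  rewrite ge0_integral_fsum//; last 2 first.
    by move=> r; exact/measurable_EFinP/measurableT_comp.
    by move=> r x _; rewrite EFinM nnfun_muleindic_ge0.
  rewrite [RHS](_ : _ = \int[mu]_x (\sum_(r \in range h)
      ((r * \1_(h @^-1` [set r]) x)%:E * (g x)%:E))); last first.
    apply: eq_integral => x _; rewrite {1}fimfunE -fsumEFin//.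
    rewrite ge0_mule_fsuml// => r.
    by rewrite EFinM nnfun_muleindic_ge0.
  rewrite ge0_integral_fsum//; last 2 first.
    move=> r; apply: emeasurable_funM => //.
    exact/measurable_EFinP/measurableT_comp.
    move=> r x _; apply: mule_ge0; last by rewrite lee_fin.
    by rewrite EFinM nnfun_muleindic_ge0.
  apply: eq_fsbigr => r; rewrite inE => -[x _ <-].
  under eq_integral do rewrite EFinM.
  under [RHS]eq_integral do rewrite EFinM -muleA.
  have mA : measurable (h @^-1` [set h x]).
    by rewrite -[X in measurable X]setTI; exact: measurable_funP.
  rewrite ge0_integralZl//; last 2 first.
    exact/measurable_EFinP.
    by rewrite lee_fin.
  rewrite ge0_integralZl//; last 3 first.
    by apply: emeasurable_funM => //; exact/measurable_EFinP.
    by move=> y _; rewrite mule_ge0// lee_fin.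
    by rewrite lee_fin.
  congr (_ * _); rewrite integral_indic// setIT nuE//.
  rewrite integral_mkcond; apply: eq_integral => y _.
  rewrite patchE indicE; case: ifP => yA; first by rewrite mul1e.
  by rewrite mul0e.
transitivity (limn (fun n => \int[nu]_x (f_ n x)%:E)).
  rewrite -monotone_convergence//.
  - by apply: eq_integral => x _; apply/esym/cvg_lim => //; exact: cvg_nnsfun_approx.
  - by move=> n; exact/measurable_EFinP.
  - by move=> n x _; rewrite lee_fin.
  - by move=> x _ a b ab; rewrite lee_fin; exact: nd.
under eq_fun do rewrite sE.
rewrite -monotone_convergence//.
- apply: eq_integral => x _; apply/cvg_lim => //.
  by apply: cvgeZr => //; exact: cvg_nnsfun_approx.
- by move=> n; apply: emeasurable_funM => //; exact/measurable_EFinP.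
- by move=> n x _; rewrite mule_ge0// lee_fin.
- by move=> x _ a b ab; rewrite lee_wpmul2r// lee_fin//; exact: nd.
Qed.
End integration.

(** * Product measures and normal densities *)

Section tensor.
Context d (T : measurableType d) (R : realType).
Variable mu : {sigma_finite_measure set T -> \bar R}.
Local Open Scope ereal_scope.

Lemma measurable_prod_tnth n (f : 'I_n -> T -> R) :
  (forall i, measurable_fun setT (f i)) ->
  measurable_fun setT (fun v : n.-tuple T => \prod_(i < n) f i (tnth v i))%R.
Proof.
move=> mf; apply: measurable_prod => i _.
by apply: measurableT_comp => //; exact: measurable_tnth.
Qed.

(** Tonelli by induction on [n]: the power measure is the image under [tuple_cons] of a product of
    two measures, and the first factor splits off. *)
Lemma ge0_integral_power_measure n (f : 'I_n -> T -> R) :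
  (forall i, measurable_fun setT (f i)) -> (forall i x, 0 <= f i x)%R ->
  \int[power_measure mu n]_v (\prod_(i < n) f i (tnth v i))%:E =
  \prod_(i < n) \int[mu]_x (f i x)%:E.
Proof.
elim: n f => [f _ _|n IH f mf f0].
  under eq_integral do rewrite big_ord0.
  rewrite [LHS]integral_dirac//; by rewrite diracT mul1e big_ord0.
have mP : measurable_fun setT
    (fun v : n.+1.-tuple T => (\prod_(i < n.+1) f i (tnth v i))%:E).
  by apply/measurable_EFinP; exact: measurable_prod_tnth.
rewrite [LHS](@ge0_integral_pushforward _ _ _ _ _ _ (@measurable_tuple_cons _ T n)
   (mu \x power_measure mu n))//; last first.
  by move=> v _; rewrite lee_fin prodr_ge0.
rewrite preimage_setT.
have E z : (\prod_(i < n.+1) f i (tnth (tuple_cons z) i))%R =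
    (f ord0 z.1 * \prod_(i < n) f (lift ord0 i) (tnth z.2 i))%R :> R.
  rewrite big_ord_recl; congr (_ * _)%R.
  by apply: eq_bigr => i _; rewrite /tuple_cons tnthS.
rewrite fubini_tonelli1; last 2 first.
- exact: (measurableT_comp mP (@measurable_tuple_cons _ T n)).
- by move=> z; rewrite /= lee_fin prodr_ge0.
rewrite /fubini_F /=.
under eq_integral do under eq_integral do rewrite E /= EFinM.
have mQ : measurable_fun setT
    (fun v : n.-tuple T => (\prod_(i < n) f (lift ord0 i) (tnth v i))%:E).
  by apply/measurable_EFinP; apply: (@measurable_prod_tnth n (fun i => f (lift ord0 i))).
have Q0 v : 0 <= (\prod_(i < n) f (lift ord0 i) (tnth v i))%:E.
  by rewrite lee_fin prodr_ge0.
under eq_integral.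
  move=> x _; rewrite ge0_integralZl//; last by rewrite lee_fin.
  over.
rewrite ge0_integralZr//; last 3 first.
- exact/measurable_EFinP.
- by move=> x _; rewrite lee_fin.
- exact: integral_ge0.
by rewrite big_ord_recl (IH (fun i => f (lift ord0 i))).
Qed.

End tensor.

(* [normal_pdf] parametrized by the variance [v]. *)
Notation nd v th x := (normal_pdf th (Num.sqrt v) x).

Section normal_density.
Context {R : realType}.
Implicit Types (v th x a : R).

Notation mu := (@lebesgue_measure R).

Lemma nd_gt0 v th x : 0 < v -> 0 < nd v th x.
Proof.
move=> v0; have s0 : Num.sqrt v != 0 by rewrite gt_eqF// sqrtr_gt0.
by rewrite normal_pdfE// mulr_gt0 ?expR_gt0// normal_peak_gt0.
Qed.

Lemma ndE v th x : 0 < v -> nd v th x =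
  (Num.sqrt (v * pi *+ 2))^-1 * expR (- (x - th) ^+ 2 / (2 * v)).
Proof.
move=> v0; have s0 : Num.sqrt v != 0 by rewrite gt_eqF// sqrtr_gt0.
rewrite normal_pdfE// /normal_peak /normal_fun sqr_sqrtr ?(ltW v0)//.
by rewrite (mulr_natl v 2).
Qed.

Lemma integral_nd v th : 0 < v -> (\int[mu]_x (nd v th x)%:E = 1)%E.
Proof. by move=> v0; rewrite integral_normal_pdf. Qed.

Lemma measurable_nd v th : measurable_fun [set: measurableTypeR R] (fun x => nd v th x).
Proof. exact: measurable_normal_pdf. Qed.

Lemma ndC v th x : 0 < v -> nd v th x = nd v x th.
Proof. by move=> v0; rewrite !ndE// -(sqrrN (x - th)) opprB. Qed.

Lemma measurable_nd2 v : 0 < v -> measurable_fun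
  [set: measurableTypeR R * measurableTypeR R] (fun z => nd v z.1 z.2).
Proof.
move=> v0; under eq_fun do rewrite ndE//.
apply: measurable_funM => //; apply: measurableT_comp => //.
apply: measurable_funM => //; apply: measurableT_comp => //.
by apply: measurable_funX; apply: measurable_funB.
Qed.

(** Centred at [a]: under mean [a] the first term fluctuates around zero and the second is the mean
    of the log ratio. *)
Lemma ln_nd_ratio v a x : 0 < v ->
  ln (nd v a x / nd v 0 x) = a * (x - a) / v + a ^+ 2 / (2 * v).
Proof.
move=> v0; rewrite !ndE// subr0 -mulf_div divff; last first.
  by rewrite invr_eq0 gt_eqF// sqrtr_gt0 mulrn_wgt0// mulr_gt0// pi_gt0.
by rewrite mul1r -expRB expRK; field; rewrite gt_eqF.
Qed.

(* [u <= 2 exp (u/2)] trades the quadratic factor for a doubled variance. *)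
Lemma nd_sqr_le v th x : 0 < v -> nd v th x * (x - th) ^+ 2 <= 8 * v * nd (2 * v) th x.
Proof.
move=> v0; have p0 := @pi_gt0 R.
have v20 : 0 < 2 * v by rewrite mulr_gt0.
rewrite !ndE//; set c := Num.sqrt _; set c' := Num.sqrt _.
have c0 : 0 < c by rewrite sqrtr_gt0 mulrn_wgt0// mulr_gt0.
have c'0 : 0 < c' by rewrite sqrtr_gt0 mulrn_wgt0// mulr_gt0.
have cc' : c' <= 2 * c.
  have vp : 0 < v * pi :> R by rewrite mulr_gt0.
  have h1 : 0 <= v * pi *+ 2 :> R by rewrite mulrn_wge0// ltW.
  have h2 : 0 <= 2 * v * pi *+ 2 :> R by rewrite mulrn_wge0// -mulrA mulr_ge0// ltW.
  rewrite -(ler_pXn2r (ltn0Sn 1)) ?nnegrE ?(ltW c'0)// ?mulr_ge0 ?(ltW c0)//.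
  by rewrite exprMn /c /c' !sqr_sqrtr//; lra.
set e := expR (- _ / (2 * (2 * v))).
have -> : expR (- (x - th) ^+ 2 / (2 * v)) = e * e.
  by rewrite -expRD; congr expR; field; rewrite gt_eqF.
have e0 : 0 < e by exact: expR_gt0.
have ue : (x - th) ^+ 2 * e <= 4 * v.
  rewrite -ler_pdivlMr// -expRN (le_trans _ (ler_wpM2l _ (expR_ge1Dx _)))//; last lra.
  rewrite !mulNr opprK mulrDr mulr1.
  suff -> : 4 * v * ((x - th) ^+ 2 / (2 * (2 * v))) = (x - th) ^+ 2 by lra.
  by field; rewrite gt_eqF.
have -> : c^-1 * (e * e) * (x - th) ^+ 2 = c^-1 * e * ((x - th) ^+ 2 * e) by ring.
apply: (@le_trans _ _ (c^-1 * e * (4 * v))).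
  by rewrite ler_wpM2l// ltW// mulr_gt0// invr_gt0.
have : c^-1 <= 2 * c'^-1.
  by rewrite -ler_pdivrMl// -invfM lef_pV2 ?posrE ?mulr_gt0//.
move=> h; have -> : c^-1 * e * (4 * v) = (4 * v * e) * c^-1 by ring.
have -> : 8 * v * (c'^-1 * e) = (4 * v * e) * (2 * c'^-1) by ring.
by rewrite ler_wpM2l// ltW// !mulr_gt0.
Qed.

(** The crude constant 8 in front of the variance suffices, because second moments enter only
    lower-order terms of the risk. *)
Lemma nd_sqr_int v th : 0 < v ->
  (\int[mu]_x (nd v th x * (x - th) ^+ 2)%:E <= (8 * v)%:E)%E.
Proof.
move=> v0; have v20 : 0 < 2 * v by rewrite mulr_gt0.
rewrite -[leRHS]mule1 -(integral_nd th v20) -ge0_integralZl//; last 3 first.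
- by apply/measurable_EFinP; exact: measurable_nd.
- by move=> x _; rewrite lee_fin normal_pdf_ge0.
- by rewrite lee_fin mulr_ge0// ltW.
apply: ge0_le_integralT => x.
  by rewrite lee_fin mulr_ge0 ?sqr_ge0// normal_pdf_ge0.
by rewrite -EFinM lee_fin nd_sqr_le.
Qed.

End normal_density.

(** * Risk bounds from bounds on the logarithmic loss *)

Section gaussian_vector.
Context {R : realType} {n : nat}.
Implicit Types (v r : R) (th x y : vec R n).
Notation mu := (@lebesgue_measure R).
Notation lv := (lebesgue_vec R n).

Lemma gaussian_pdf_gt0 th v y : 0 < v -> 0 < gaussian_pdf th v y.
Proof. by move=> v0; apply: prodr_gt0 => i _; exact: nd_gt0. Qed.

Lemma integral_gaussian_coord th v i (f : measurableTypeR R -> R) : 0 < v ->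
  measurable_fun setT f -> (forall a, 0 <= f a) ->
  (\int[lv]_y (gaussian_pdf th v y * f (tnth y i))%:E =
   \int[mu]_a (nd v (tnth th i) a * f a)%:E)%E.
Proof.
move=> v0 mf f0.
pose F j (a : measurableTypeR R) : R := nd v (tnth th j) a * (if j == i then f a else 1).
have mF j : measurable_fun setT (F j).
  apply: measurable_funM; first exact: measurable_nd.
  by case: (j == i).
have F0 j a : 0 <= F j a.
  by rewrite mulr_ge0 ?normal_pdf_ge0//; case: (j == i).
transitivity (\int[lv]_y (\prod_(j < n) F j (tnth y j))%:E)%E.
  apply: eq_integral => y _; congr EFin; rewrite /F big_split/=; congr (_ * _).
  rewrite (bigD1 i)//= eqxx big1 ?mulr1// => j /negbTE ->//.
rewrite [LHS](@ge0_integral_power_measure _ _ _ mu n F mF F0).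
rewrite (bigD1 i)//= big1 ?mule1; last first.
  move=> j /negbTE ji; rewrite /F ji.
  by under eq_integral do rewrite mulr1; exact: integral_nd.
by apply: eq_integral => a _; rewrite /F eqxx.
Qed.

Lemma integral_gaussian th v : 0 < v ->
  (\int[lv]_y (gaussian_pdf th v y)%:E = 1)%E.
Proof.
move=> v0; rewrite [LHS](@ge0_integral_power_measure _ _ _ mu n
  (fun i (a : measurableTypeR R) => nd v (tnth th i) a)).
- by rewrite big1// => i _; exact: integral_nd.
- by move=> i; exact: measurable_nd.
- by move=> i a; exact: normal_pdf_ge0.
Qed.

Lemma integrable_gaussian th v c : 0 < v ->
  lv.-integrable setT (fun y => (c * gaussian_pdf th v y)%:E).
Proof.
move=> v0; under eq_fun do rewrite EFinM; apply: integrableZl => //.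
apply/integrableP; split.
  by apply/measurable_EFinP; exact: measurable_gaussian_pdf.
under eq_integral do rewrite gee0_abs ?lee_fin ?gaussian_pdf_ge0//.
by rewrite integral_gaussian// ltry.
Qed.

Lemma integral_cst_gaussian th v c : 0 < v ->
  (\int[lv]_y (c * gaussian_pdf th v y)%:E = c%:E)%E.
Proof.
move=> v0; under eq_integral do rewrite EFinM.
rewrite integralZl//; first by rewrite integral_gaussian// mule1.
by have := integrable_gaussian th 1 v0; under eq_fun do rewrite mul1r.
Qed.

End gaussian_vector.

(** * Expectations under the joint law of the two observations *)

Section joint_expectation.
Context {R : realType} {n : nat}.
Variables (r : R) (th : vec R n).
Hypothesis r0 : 0 < r.
Implicit Types (x y : vec R n) (B : vec R n * vec R n -> R).
Notation mu := (@lebesgue_measure R).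
Notation lv := (lebesgue_vec R n).
Local Open Scope ereal_scope.

Definition joint_expect B : \bar R :=
  \int[lv \x lv]_z (gaussian_pdf th 1 z.1 * gaussian_pdf th r z.2 * B z)%:E.

Let pdf_ge0 z : (0 <= gaussian_pdf th 1 z.1 * gaussian_pdf th r z.2)%R.
Proof. by rewrite mulr_ge0// gaussian_pdf_ge0. Qed.

Let mpdf : measurable_fun [set: vec R n * vec R n]
  (fun z => gaussian_pdf th 1 z.1 * gaussian_pdf th r z.2)%R.
Proof.
apply: measurable_funM.
  exact: (measurableT_comp (measurable_gaussian_pdf _ _) measurable_fst).
exact: (measurableT_comp (measurable_gaussian_pdf _ _) measurable_snd).
Qed.

Let mintegrand B : measurable_fun setT B -> measurable_fun setT
  (fun z => (gaussian_pdf th 1 z.1 * gaussian_pdf th r z.2 * B z)%:E).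
Proof. by move=> mB; apply/measurable_EFinP; exact: measurable_funM. Qed.

Lemma joint_expect_ge0 B : (forall z, 0 <= B z)%R -> 0 <= joint_expect B.
Proof. by move=> B0; apply: integral_ge0 => z _; rewrite lee_fin mulr_ge0. Qed.

Lemma joint_expectE B : measurable_fun setT B -> (forall z, 0 <= B z)%R ->
  joint_expect B = \int[lv]_x
    (\int[lv]_y (gaussian_pdf th r y * B (x, y))%:E * (gaussian_pdf th 1 x)%:E).
Proof.
move=> mB B0; rewrite /joint_expect fubini_tonelli1; last 2 first.
- exact: mintegrand.
- by move=> z; rewrite lee_fin mulr_ge0.
apply: eq_integral => x _; rewrite /fubini_F /=.
under eq_integral do rewrite -mulrA EFinM.
rewrite ge0_integralZl//; first by rewrite muleC.
- apply/measurable_EFinP; apply: measurable_funM; first exact: measurable_gaussian_pdf.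
  exact: (measurableT_comp mB (measurable_pair1 _)).
- by move=> y _; rewrite lee_fin mulr_ge0// gaussian_pdf_ge0.
- by rewrite lee_fin gaussian_pdf_ge0.
Qed.

(** All coordinates but [i] integrate to 1, and the two observations of coordinate [i] are
    independent. *)
Lemma joint_expect_coord i (f g : measurableTypeR R -> R) :
  measurable_fun setT f -> measurable_fun setT g ->
  (forall a, 0 <= f a)%R -> (forall a, 0 <= g a)%R ->
  joint_expect (fun z => f (tnth z.1 i) * g (tnth z.2 i))%R =
  \int[mu]_a (nd 1 (tnth th i) a * f a)%:E * \int[mu]_a (nd r (tnth th i) a * g a)%:E.
Proof.
move=> mf mg f0 g0.
have mt f' : measurable_fun setT f' ->
    measurable_fun setT (fun x : vec R n => f' (tnth x i) : R).
  by move=> mf'; apply: measurableT_comp => //; exact: measurable_tnth.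
rewrite joint_expectE/=; last 2 first.
- by apply: measurable_funM;
    [exact: (measurableT_comp (mt f mf) measurable_fst)
    |exact: (measurableT_comp (mt g mg) measurable_snd)].
- by move=> z; rewrite mulr_ge0.
set J := \int[mu]_a (nd r (tnth th i) a * g a)%:E.
have JE x : \int[lv]_y (gaussian_pdf th r y * (f (tnth x i) * g (tnth y i)))%:E
    = (f (tnth x i))%:E * J.
  rewrite /J -(integral_gaussian_coord _ _ r0 mg g0) -ge0_integralZl//.
  - by apply: eq_integral => y _; rewrite -EFinM; congr EFin; ring.
  - apply/measurable_EFinP; apply: measurable_funM; first exact: measurable_gaussian_pdf.
    exact: mt.
  - by move=> y _; rewrite lee_fin mulr_ge0// gaussian_pdf_ge0.
  - by rewrite lee_fin.
under eq_integral do rewrite JE.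
rewrite -(integral_gaussian_coord _ _ ltr01 mf f0) -ge0_integralZr//.
- by apply: eq_integral => x _; rewrite muleAC -EFinM mulrC.
- apply/measurable_EFinP; apply: measurable_funM; first exact: measurable_gaussian_pdf.
  exact: mt.
- by move=> y _; rewrite lee_fin mulr_ge0// gaussian_pdf_ge0.
- by apply: integral_ge0 => a _; rewrite lee_fin mulr_ge0// normal_pdf_ge0.
Qed.

Lemma joint_expectD B B' : measurable_fun setT B -> measurable_fun setT B' ->
  (forall z, 0 <= B z)%R -> (forall z, 0 <= B' z)%R ->
  joint_expect (fun z => B z + B' z)%R = joint_expect B + joint_expect B'.
Proof.
move=> mB mB' B0 B'0; rewrite /joint_expect.
under eq_integral do rewrite mulrDr EFinD.
by rewrite ge0_integralD//; try exact: mintegrand;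
  move=> z _; rewrite lee_fin mulr_ge0.
Qed.

Lemma joint_expectZ c B : (0 <= c)%R -> measurable_fun setT B ->
  (forall z, 0 <= B z)%R ->
  joint_expect (fun z => c * B z)%R = c%:E * joint_expect B.
Proof.
move=> c0 mB B0; rewrite /joint_expect.
under eq_integral do rewrite mulrCA EFinM.
by rewrite ge0_integralZl//; [exact: mintegrand|move=> z _; rewrite lee_fin mulr_ge0].
Qed.

Lemma joint_expect_sum (I : Type) (s : seq I) (P : pred I) (F : I -> vec R n * vec R n -> R) :
  (forall i, measurable_fun setT (F i)) -> (forall i z, 0 <= F i z)%R ->
  joint_expect (fun z => \sum_(i <- s | P i) F i z)%R =
  \sum_(i <- s | P i) joint_expect (F i).
Proof.
move=> mF F0; rewrite /joint_expect.
under eq_integral do rewrite mulr_sumr -sumEFin big_mkcond/=.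
rewrite ge0_integral_sum//=; last 2 first.
- by move=> i; case: (P i) => //; exact: mintegrand.
- by move=> i z _; case: (P i) => //; rewrite lee_fin mulr_ge0.
rewrite [RHS]big_mkcond/=; apply: eq_bigr => i _; case: (P i) => //.
by rewrite (integral0 (lv \x lv)).
Qed.

Variable q : vec R n -> vec R n -> R.

Let loss x y := lne ((gaussian_pdf th r y)%:E / (q x y)%:E).

(** Reduces a risk bound to a pointwise bound on the logarithmic loss. The constant [A] may be
    negative and integrates to itself; [B] is nonnegative, so that Tonelli applies to it. *)
Lemma risk_le (A : R) B : measurable_fun setT B -> (forall z, 0 <= B z)%R ->
  (forall x y, loss x y <= (A + B (x, y))%:E) ->
  risk r th q <= A%:E + joint_expect B.
Proof.
move=> mB B0 AB.
have mBx x : measurable_fun setT (fun y => (gaussian_pdf th r y * B (x, y))%:E).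
  apply/measurable_EFinP; apply: measurable_funM; first exact: measurable_gaussian_pdf.
  exact: (measurableT_comp mB (measurable_pair1 _)).
have B0x x y : 0 <= (gaussian_pdf th r y * B (x, y))%:E.
  by rewrite lee_fin mulr_ge0// gaussian_pdf_ge0.
pose b x := \int[lv]_y (gaussian_pdf th r y * B (x, y))%:E.
have b0 x : 0 <= b x by exact: integral_ge0.
have klb x : kl_loss r th (q x) <= A%:E + b x.
  rewrite -(integral_cst_gaussian th A r0); apply: le_integral_add => //.
    exact: integrable_gaussian.
  move=> y; rewrite -EFinD mulrC -mulrDr EFinM.
  by apply: lee_wpmul2l; [rewrite lee_fin gaussian_pdf_ge0|exact: AB].
rewrite joint_expectE// -(integral_cst_gaussian th A ltr01).
apply: le_integral_add => //.
- exact: integrable_gaussian.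
- apply: emeasurable_funM; last first.
    by apply/measurable_EFinP; exact: measurable_gaussian_pdf.
  apply: (@measurable_fun_fubini_tonelli_F _ _ _ _ _ lv
    (fun z => (gaussian_pdf th r z.2 * B z)%:E)).
    apply/measurable_EFinP; apply: measurable_funM => //.
    exact: (measurableT_comp (measurable_gaussian_pdf _ _) measurable_snd).
  by move=> z; rewrite lee_fin mulr_ge0// gaussian_pdf_ge0.
- by move=> x; apply: mule_ge0; [exact: b0|rewrite lee_fin gaussian_pdf_ge0].
- move=> x; rewrite EFinM -muleDl//.
  by apply: lee_wpmul2r; [rewrite lee_fin gaussian_pdf_ge0|exact: klb].
Qed.

(** The counterpart from below, for an arbitrary [q]; when [B] has infinite expectation the bound
    degenerates to [-oo]. *)
Lemma risk_ge (A : R) B : measurable_fun setT B -> (forall z, 0 <= B z)%R ->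
  (forall x y, (A - B (x, y))%:E <= loss x y) ->
  A%:E - joint_expect B <= risk r th q.
Proof.
move=> mB B0 AB.
have mBx x : measurable_fun setT (fun y => (gaussian_pdf th r y * B (x, y))%:E).
  apply/measurable_EFinP; apply: measurable_funM; first exact: measurable_gaussian_pdf.
  exact: (measurableT_comp mB (measurable_pair1 _)).
have B0x x y : 0 <= (gaussian_pdf th r y * B (x, y))%:E.
  by rewrite lee_fin mulr_ge0// gaussian_pdf_ge0.
pose b x := \int[lv]_y (gaussian_pdf th r y * B (x, y))%:E.
have b0 x : 0 <= b x by exact: integral_ge0.
have klb x : A%:E - b x <= kl_loss r th (q x).
  rewrite -(integral_cst_gaussian th A r0); apply: ge_integral_sub => //.
    exact: integrable_gaussian.
  move=> y; rewrite -EFinB mulrC -mulrBr EFinM.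
  by apply: lee_wpmul2l; [rewrite lee_fin gaussian_pdf_ge0|exact: AB].
rewrite joint_expectE// -(integral_cst_gaussian th A ltr01).
apply: ge_integral_sub => //.
- exact: integrable_gaussian.
- apply: emeasurable_funM; last first.
    by apply/measurable_EFinP; exact: measurable_gaussian_pdf.
  apply: (@measurable_fun_fubini_tonelli_F _ _ _ _ _ lv
    (fun z => (gaussian_pdf th r z.2 * B z)%:E)).
    apply/measurable_EFinP; apply: measurable_funM => //.
    exact: (measurableT_comp (measurable_gaussian_pdf _ _) measurable_snd).
  by move=> z; rewrite lee_fin mulr_ge0// gaussian_pdf_ge0.
- by move=> x; apply: mule_ge0; [exact: b0|rewrite lee_fin gaussian_pdf_ge0].
- move=> x; rewrite EFinM -muleBl//.
  by apply: lee_wpmul2r; [rewrite lee_fin gaussian_pdf_ge0|exact: klb].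
Qed.

End joint_expectation.

(** * The predictive density of a product prior *)

Lemma le_measure_integral d (T : measurableType d) (R : realType)
    (P : {measure set T -> \bar R}) (A : set T) (f : T -> R) (c : R) :
  measurable A -> 0 <= c -> (forall x, 0 <= f x) -> (forall x, A x -> c <= f x) ->
  (c%:E * P A <= \int[P]_x (f x)%:E)%E.
Proof.
move=> mA c0 f0 cf.
have -> : (c%:E * P A = \int[P]_x (c * \1_A x)%:E)%E.
  under eq_integral do rewrite EFinM.
  rewrite ge0_integralZl//; first by rewrite integral_indic// setIT.
  exact/measurable_EFinP.
apply: ge0_le_integralT => x; rewrite lee_fin ?mulr_ge0// indicE.
by case: (boolP (x \in A)) => [|_]; rewrite ?mulr0// inE mulr1 => /cf.
Qed.

Lemma measurable_inv_pos d (T : measurableType d) (R : realType) (f : T -> R) :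
  measurable_fun setT f -> (forall x, 0 < f x) ->
  measurable_fun setT (fun x => (f x)^-1).
Proof.
move=> mf f0; have -> : (fun x => (f x)^-1) = (fun x => expR (- ln (f x))).
  by apply/funext => x; rewrite expRN lnK// posrE.
apply: measurableT_comp => //; apply: measurableT_comp => //.
exact: (measurableT_comp (@measurable_ln R)).
Qed.

Section marginals.
Context {R : realType}.
Variables (p : probability (measurableTypeR R) R) (r : R).
Hypothesis r0 : 0 < r.
Implicit Types a b : measurableTypeR R.
Notation mu := (@lebesgue_measure R).

Lemma measurable_nd_mean v a : 0 < v ->
  measurable_fun [set: measurableTypeR R] (fun t => nd v t a).
Proof.
by move=> v0; under eq_fun do rewrite ndC//; exact: measurable_nd.
Qed.

Lemma measurable_nd_mean2 a b :
  measurable_fun [set: measurableTypeR R] (fun t => nd 1 t a * nd r t b).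
Proof. by apply: measurable_funM; exact: measurable_nd_mean. Qed.

(** The density of one coordinate of X when its mean is drawn from [p]; [marginal2] is that of the
    pair of observations. Normal densities are bounded by their peaks, so [fine] is applied to
    finite integrals only. *)
Definition marginal1 a : R := fine (\int[p]_t (nd 1 t a)%:E)%E.

Definition marginal2 a b : R := fine (\int[p]_t (nd 1 t a * nd r t b)%:E)%E.

Let pT : p [set: measurableTypeR R] = 1%E := probability_setT p.

Let nd_ub v t a : 0 < v -> nd v t a <= normal_peak (Num.sqrt v).
Proof. by move=> v0; apply: normal_pdf_ub; rewrite gt_eqF// sqrtr_gt0. Qed.

Let bounded_fin (f : measurableTypeR R -> R) c : (forall x, 0 <= f x) ->
  (forall x, f x <= c) -> (\int[p]_t (f t)%:E)%E \is a fin_num.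
Proof.
move=> f0 fc; rewrite ge0_fin_numE; last by apply: integral_ge0 => x _; rewrite lee_fin.
apply: (@le_lt_trans _ _ (\int[p]_t c%:E)%E).
  by apply: ge0_le_integralT => x; rewrite lee_fin.
by rewrite integral_cst// [X in (_ * X)%E]pT mule1 ltry.
Qed.

Lemma marginal1E a : (marginal1 a)%:E = (\int[p]_t (nd 1 t a)%:E)%E.
Proof.
rewrite fineK// (@bounded_fin _ (normal_peak (Num.sqrt 1)))// => t.
  exact: normal_pdf_ge0.
exact: nd_ub.
Qed.

Lemma marginal2E a b :
  (marginal2 a b)%:E = (\int[p]_t (nd 1 t a * nd r t b)%:E)%E.
Proof.
rewrite fineK// (@bounded_fin _ (normal_peak (Num.sqrt 1) * normal_peak (Num.sqrt r)))// => t.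
  by rewrite mulr_ge0// normal_pdf_ge0.
by rewrite ler_pM ?normal_pdf_ge0// nd_ub.
Qed.

Lemma marginal1_ge0 a : 0 <= marginal1 a.
Proof.
by rewrite -lee_fin marginal1E; apply: integral_ge0 => t _; rewrite lee_fin normal_pdf_ge0.
Qed.

Lemma marginal2_ge0 a b : 0 <= marginal2 a b.
Proof.
rewrite -lee_fin marginal2E; apply: integral_ge0 => t _.
by rewrite lee_fin mulr_ge0// normal_pdf_ge0.
Qed.

Lemma measurable_marginal1 : measurable_fun setT marginal1.
Proof.
apply: measurableT_comp => //.
apply: (@measurable_fun_fubini_tonelli_F _ _ _ _ _ p (fun z => (nd 1 z.2 z.1)%:E)).
  apply/measurable_EFinP; under eq_fun do rewrite ndC//.
  exact: measurable_nd2.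
by move=> z; rewrite lee_fin normal_pdf_ge0.
Qed.

Lemma measurable_marginal2 : measurable_fun
  [set: measurableTypeR R * measurableTypeR R] (fun z => marginal2 z.1 z.2).
Proof.
pose T3 := ((measurableTypeR R * measurableTypeR R) * measurableTypeR R)%type.
have m1 : measurable_fun [set: T3] (fun w : T3 => (w.1.1, w.2)).
  apply/measurable_fun_pairP; split; last exact: measurable_snd.
  exact: (measurableT_comp measurable_fst measurable_fst).
have m2 : measurable_fun [set: T3] (fun w : T3 => (w.1.2, w.2)).
  apply/measurable_fun_pairP; split; last exact: measurable_snd.
  exact: (measurableT_comp measurable_snd measurable_fst).
pose F (z : measurableTypeR R * measurableTypeR R) :=
  (\int[p]_t (nd 1 t z.1 * nd r t z.2)%:E)%E.
suff mF : measurable_fun setT F.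
  have h : measurable_fun setT (fine \o F) by exact: measurableT_comp.
  exact: h.
apply: (@measurable_fun_fubini_tonelli_F _ _ _ _ _ p
    (fun w : (measurableTypeR R * measurableTypeR R) * measurableTypeR R =>
    (nd 1 w.2 w.1.1 * nd r w.2 w.1.2)%:E)).
  apply/measurable_EFinP; apply: measurable_funM.
    under eq_fun do rewrite ndC//.
    exact: (measurableT_comp (measurable_nd2 (@ltr01 R)) m1).
  under eq_fun do rewrite ndC//.
  exact: (measurableT_comp (measurable_nd2 r0) m2).
by move=> z; rewrite lee_fin mulr_ge0// normal_pdf_ge0.
Qed.

Lemma integral_marginal1 : (\int[mu]_a (marginal1 a)%:E = 1)%E.
Proof.
under eq_integral do rewrite marginal1E.
rewrite (@fubini_tonelli _ _ _ _ _ mu p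
    (fun z : measurableTypeR R * measurableTypeR R => (nd 1 z.2 z.1)%:E)) /=.
- under eq_integral do rewrite integral_nd//.
  by rewrite integral_cst// [X in (_ * X)%E]pT mule1.
- apply/measurable_EFinP; under eq_fun do rewrite ndC//.
  exact: measurable_nd2.
- by move=> z; rewrite lee_fin normal_pdf_ge0.
Qed.

Lemma integral_marginal2 a : (\int[mu]_b (marginal2 a b)%:E = (marginal1 a)%:E)%E.
Proof.
under eq_integral do rewrite marginal2E.
rewrite marginal1E.
rewrite (@fubini_tonelli _ _ _ _ _ mu p
    (fun z : measurableTypeR R * measurableTypeR R => (nd 1 z.2 a * nd r z.2 z.1)%:E)) /=.
- apply: eq_integral => t _; under eq_integral do rewrite EFinM.
  rewrite ge0_integralZl//; first by rewrite integral_nd// mule1.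
  + by apply/measurable_EFinP; exact: measurable_nd.
  + by move=> x _; rewrite lee_fin normal_pdf_ge0.
  + by rewrite lee_fin normal_pdf_ge0.
- apply/measurable_EFinP; apply: measurable_funM.
    apply: (measurableT_comp (measurable_nd_mean a (@ltr01 R)) measurable_snd).
  under eq_fun do rewrite ndC//.
  exact: measurable_nd2.
- by move=> z; rewrite lee_fin mulr_ge0// normal_pdf_ge0.
Qed.

Lemma marginal1_ge A c a : measurable A -> 0 <= c ->
  (forall t, A t -> c <= nd 1 t a) -> (c%:E * p A <= (marginal1 a)%:E)%E.
Proof.
by move=> mA c0 cA; rewrite marginal1E; apply: le_measure_integral => // t; exact: normal_pdf_ge0.
Qed.

(** Only the prior mass of [A] is kept. The choice [[set 0]] compares with the spike, a unit
    interval inside the support with the slab. *)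
Lemma marginal2_ge A c a b : measurable A -> 0 <= c ->
  (forall t, A t -> c <= nd 1 t a * nd r t b) -> (c%:E * p A <= (marginal2 a b)%:E)%E.
Proof.
move=> mA c0 cA; rewrite marginal2E; apply: le_measure_integral => // t.
by rewrite mulr_ge0// normal_pdf_ge0.
Qed.

Hypothesis p0 : (0 < p [set 0%R])%E.

Lemma marginal1_gt0 a : 0 < marginal1 a.
Proof.
rewrite -lte_fin; apply: (@lt_le_trans _ _ ((nd 1 0 a)%:E * p [set 0%R])%E).
  by rewrite mule_gt0// lte_fin nd_gt0.
by apply: marginal1_ge => // [|t ->//]; exact: normal_pdf_ge0.
Qed.

Lemma marginal2_gt0 a b : 0 < marginal2 a b.
Proof.
rewrite -lte_fin; apply: (@lt_le_trans _ _ ((nd 1 0 a * nd r 0 b)%:E * p [set 0%R])%E).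
  by rewrite mule_gt0// lte_fin mulr_gt0// nd_gt0.
by apply: marginal2_ge => // [|t ->//]; rewrite mulr_ge0// normal_pdf_ge0.
Qed.

Variable n : nat.
Implicit Types x y : vec R n.
Notation P := (power_measure p n).

Let measurable_gaussian_mean v y : 0 < v ->
  measurable_fun setT (fun th : vec R n => gaussian_pdf th v y).
Proof.
move=> v0; have -> : (fun th => gaussian_pdf th v y) = gaussian_pdf y v.
  by apply/funext => th; rewrite gaussian_pdfC.
exact: measurable_gaussian_pdf.
Qed.

(** Prior and likelihoods factor over the coordinates, so both the integral against the prior and
    the normalizing mass are products of univariate marginals. *)
Lemma bayes_predictiveE x y : bayes_predictive P r x y =
  \prod_(i < n) (marginal2 (tnth x i) (tnth y i) / marginal1 (tnth x i)).
Proof.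
have massE : joint_measure P x setT = (\prod_(i < n) marginal1 (tnth x i))%:E.
  rewrite -prodEFin; under [RHS]eq_bigr do rewrite marginal1E.
  rewrite [LHS](@ge0_integral_power_measure _ _ _ p n
    (fun i (t : measurableTypeR R) => nd 1 t (tnth x i)))//.
  - by move=> i; exact: measurable_nd_mean.
  - by move=> i t; exact: normal_pdf_ge0.
set M := (\prod_(i < n) marginal1 (tnth x i)) in massE *.
have M0 : 0 < M by apply: prodr_gt0 => i _; exact: marginal1_gt0.
have postE A : measurable A -> posterior P x A =
    (\int[P]_(th in A) (gaussian_pdf th 1 x * M^-1)%:E)%E.
  (* The mass [M] is positive and finite, which excludes the two cases where [mnormalize] returns
     its default. *)
  move=> mA; rewrite /posterior /mnormalize; case: ifPn => [/orP[]/eqP h|_].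
  - by have /eqP := etrans (esym massE) h; rewrite eqe gt_eqF.
  - by have := etrans (esym massE) h.
  rewrite (_ : fine _ = M); last exact: (congr1 fine massE).
  under eq_integral do rewrite EFinM.
  rewrite ge0_integralZr//.
  - by apply/measurable_EFinP; apply: measurable_funTS; exact: measurable_gaussian_mean.
  - by move=> th _; rewrite lee_fin gaussian_pdf_ge0.
  - by rewrite lee_fin invr_ge0 ltW.
rewrite /bayes_predictive /Rintegral.
rewrite (ge0_integral_density (mu := P) (nu := posterior P x)
  (g := fun th => gaussian_pdf th 1 x * M^-1))//; last 4 first.
- by apply: measurable_funM => //; exact: measurable_gaussian_mean.
- by move=> th; rewrite mulr_ge0 ?gaussian_pdf_ge0// invr_ge0 ltW.
- by apply/measurable_EFinP; exact: measurable_gaussian_mean.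
- by move=> th; rewrite lee_fin gaussian_pdf_ge0.
rewrite (_ : (\int[P]_th _)%E = (\prod_(i < n) marginal2 (tnth x i) (tnth y i) * M^-1)%:E).
  by rewrite /= -prodfV -big_split.
rewrite EFinM -prodEFin; under [in RHS]eq_bigr do rewrite marginal2E.
rewrite -(@ge0_integral_power_measure _ _ _ p n
    (fun i (t : measurableTypeR R) => nd 1 t (tnth x i) * nd r t (tnth y i))); last 2 first.
- by move=> i; exact: measurable_nd_mean2.
- by move=> i t; rewrite mulr_ge0// normal_pdf_ge0.
rewrite -ge0_integralZr//.
- by apply: eq_integral => th _; rewrite -!EFinM big_split/= mulrA (mulrC (gaussian_pdf _ r y)).
- apply/measurable_EFinP; apply: (@measurable_prod_tnth _ _ _ n (fun i (t : measurableTypeR R) =>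
    nd 1 t (tnth x i) * nd r t (tnth y i))).
  by move=> i; exact: measurable_nd_mean2.
- by move=> th _; rewrite lee_fin; apply: prodr_ge0 => i _; rewrite mulr_ge0// normal_pdf_ge0.
- by rewrite lee_fin invr_ge0 ltW.
Qed.

(** Each factor integrates to 1 in [y] because [marginal2 a] integrates to [marginal1 a]. Hence the
    Bayes estimate competes in the infimum defining the minimax risk. *)
Lemma bayes_predictive_density : predictive_density (bayes_predictive P r).
Proof.
have m2 : measurable_fun [set: measurableTypeR R * measurableTypeR R]
    (fun z => marginal2 z.1 z.2 / marginal1 z.1).
  apply: measurable_funM; first exact: measurable_marginal2.
  apply: measurable_inv_pos; last by move=> z; exact: marginal1_gt0.
  exact: (measurableT_comp measurable_marginal1 measurable_fst).
split.
- under eq_fun do rewrite bayes_predictiveE.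
  apply: measurable_prod => i _.
  have mi : measurable_fun [set: vec R n * vec R n] (fun z => (tnth z.1 i, tnth z.2 i)).
    apply/measurable_fun_pairP; split => /=.
      exact: (measurableT_comp (measurable_tnth i) measurable_fst).
    exact: (measurableT_comp (measurable_tnth i) measurable_snd).
  exact: (measurableT_comp m2 mi).
- move=> x y; rewrite bayes_predictiveE; apply: prodr_ge0 => i _.
  by rewrite divr_ge0// ?marginal1_ge0 ?marginal2_ge0.
- move=> x; under eq_integral do rewrite bayes_predictiveE.
  rewrite [LHS](@ge0_integral_power_measure _ _ _ mu n
    (fun i (b : measurableTypeR R) => marginal2 (tnth x i) b / marginal1 (tnth x i))).
  + rewrite big1// => i _; under eq_integral do rewrite EFinM.
    rewrite ge0_integralZr//.
    * rewrite integral_marginal2 -EFinM divff// gt_eqF//; exact: marginal1_gt0.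
    * apply/measurable_EFinP.
      exact: (measurableT_comp measurable_marginal2 (measurable_pair1 _)).
    * by move=> b _; rewrite lee_fin marginal2_ge0.
    * by rewrite lee_fin invr_ge0 marginal1_ge0.
  + move=> i; apply: measurable_funM => //.
    exact: (measurableT_comp measurable_marginal2 (measurable_pair1 _)).
  + by move=> i b; rewrite divr_ge0// ?marginal1_ge0 ?marginal2_ge0.
Qed.

End marginals.

(** * Univariate spike-and-slab bounds *)

(** The sum of all constants and coefficients of squares met in the near and far cases below, so
    that it dominates each of them; the square root is the inverse of the peak of the standard
    normal density. *)
Definition loss_const (R : realType) (r dl : R) : R :=
  2 * ln 2 - ln (Num.sqrt (1 * pi *+ 2))^-1 + 1 + r^-1 + (1 + dl^-1) + r^-1
    + (2 * dl * r ^+ 2)^-1.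

Section spike_slab_bounds.
Context {R : realType}.
Variables (eta l r : R).
Hypotheses (eta0 : 0 < eta) (eta_half : eta <= 2^-1) (l2 : 2 <= l) (r0 : 0 < r).
Notation mu := (@lebesgue_measure R).
Notation p := (spike_slab eta l).
Implicit Types a b x y th : R.

Local Ltac hlra :=
  have := eta0; have := eta_half; have := l2; move=> ? ? ?; lra.

Let in_range : (0 <= eta <= 1) && (0 < l).
Proof. by apply/andP; split; [apply/andP; split|]; hlra. Qed.

Let slab_ge0 : (0 <= (eta / (2 * l))%:E)%E.
Proof. by rewrite lee_fin; apply: divr_ge0; hlra. Qed.

Lemma spike_slab_point : ((1 - eta)%:E <= p [set 0%R])%E.
Proof.
rewrite /spike_slab in_range diracE mem_set// mule1 leeDl//.
by apply: mule_ge0 => //; exact: measure_ge0.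
Qed.

Lemma spike_slab_point_gt0 : (0 < p [set 0%R])%E.
Proof. by apply: lt_le_trans spike_slab_point; rewrite lte_fin; hlra. Qed.

Lemma spike_slab_itv a : - l <= a -> a + 1 <= l ->
  ((eta / (2 * l))%:E <= p `[a, (a + 1)%R]%classic)%E.
Proof.
move=> la al; rewrite /spike_slab in_range.
rewrite (_ : `[a, a + 1]%classic `&` `[- l, l]%classic = `[a, a + 1]%classic); last first.
  apply/seteqP; split => [z [] //|z /= za]; split => //.
  by move: za; rewrite /= !in_itv/= => /andP[? ?]; apply/andP; split; hlra.
rewrite lebesgue_measure_itv/= lte_fin ltrDl ltr01 -EFinD.
rewrite (_ : a + 1 - a = 1)%R; last by ring.
by rewrite lee_fin mulr1 lerDr mulr_ge0//; hlra.
Qed.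

(** By symmetry the normal density integrates to 1 in its mean as well, so the slab contributes at
    most its height [eta / (2 * l)]. *)
Lemma marginal1_spike_slab_le x : marginal1 p x <= nd 1 0 x + eta / (2 * l).
Proof.
have e1 : 0 <= 1 - eta by hlra.
have e2 : 0 <= eta / (2 * l) by rewrite -lee_fin.
have mI : measurable (`[- l, l]%classic : set (measurableTypeR R)).
  exact: measurable_itv.
have mf : measurable_fun [set: measurableTypeR R] (fun t : measurableTypeR R => (nd 1 t x)%:E).
  by apply/measurable_EFinP; exact: measurable_nd_mean.
have f0 (t : measurableTypeR R) : (0 <= (nd 1 t x)%:E)%E by rewrite lee_fin normal_pdf_ge0.
pose m1 : {measure set (measurableTypeR R) -> \bar R} :=
  mscale (NngNum e1) (dirac (0%R : measurableTypeR R)).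
pose m2 : {measure set (measurableTypeR R) -> \bar R} :=
  mscale (NngNum e2) (mrestr mu mI).
have pE : p = measure_add m1 m2.
  by apply/funext => A; rewrite [RHS]measure_addE /spike_slab in_range.
have addE : (\int[p]_t (nd 1 t x)%:E =
    \int[m1]_t (nd 1 t x)%:E + \int[m2]_t (nd 1 t x)%:E)%E.
  by rewrite pE; exact: ge0_integral_measure_add.
have m1E : (\int[m1]_t (nd 1 t x)%:E = (1 - eta)%:E * (nd 1 0 x)%:E)%E.
  rewrite [LHS](ge0_integral_mscale _ measurableT)//; congr (_ * _)%E.
  by rewrite integral_dirac// diracT mul1e.
have m2E : (\int[m2]_t (nd 1 t x)%:E =
    (eta / (2 * l))%:E * \int[mrestr mu mI]_t (nd 1 t x)%:E)%E.
  by rewrite [LHS](ge0_integral_mscale _ measurableT).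
have restr_le : (\int[mrestr mu mI]_t (nd 1 t x)%:E <= 1)%E.
  rewrite (@ge0_integral_density _ _ _ mu (mrestr mu mI) \1_(`[- l, l]%classic))//; last first.
    by move=> A mA; rewrite integral_indic// setIC.
  rewrite -(integral_nd x (@ltr01 R)); apply: ge0_le_integralT => t; last first.
    by rewrite ndC// -EFinM lee_fin ler_piMr ?normal_pdf_ge0// indicE.
  by rewrite mule_ge0// lee_fin.
rewrite -lee_fin marginal1E addE m1E m2E [leRHS]EFinD; apply: leeD.
  by rewrite -EFinM lee_fin ler_piMl ?normal_pdf_ge0//; hlra.
by rewrite -[leRHS]mule1 lee_wpmul2l.
Qed.

Let L := ln eta^-1.

Let expNL : expR (- L) = eta.
Proof. by rewrite /L lnV ?posrE// opprK lnK. Qed.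

Let L_ge0 : 0 <= L.
Proof. by rewrite ln_ge0// invf_ge1//; hlra. Qed.

Let peak v : R := (Num.sqrt (v * pi *+ 2))^-1.

Let peak_gt0 v : 0 < v -> 0 < peak v.
Proof. by move=> v0; rewrite invr_gt0 sqrtr_gt0 mulrn_wgt0// mulr_gt0// pi_gt0. Qed.

Let peak1_le1 : peak 1 <= 1.
Proof.
rewrite invf_le1 ?sqrtr_gt0 ?mulrn_wgt0 ?mulr_gt0 ?pi_gt0//.
by rewrite -[X in X <= _]sqrtr1 ler_wsqrtr//; have := @pi_ge2 R; lra.
Qed.

(** Spike and slab contribute at most [expR (- x ^+ 2 / 2)] and [eta = expR (- L)]; the larger one,
    doubled, bounds the sum. *)
Let ln_marginal1 x : ln (marginal1 p x) <= ln 2 - Num.min (x ^+ 2 / 2) L.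
Proof.
set m := Num.min _ _.
have m1 : m <= x ^+ 2 / 2 by rewrite ge_min lexx.
have m2 : m <= L by rewrite ge_min lexx orbT.
have e0 := expR_gt0 (- m).
rewrite -[leRHS]expRK ler_ln ?posrE ?expR_gt0//; last first.
  by apply: marginal1_gt0; exact: spike_slab_point_gt0.
rewrite expRD lnK ?posrE//.
apply: le_trans (marginal1_spike_slab_le x) _.
rewrite (_ : 2 * expR (- m) = expR (- m) + expR (- m)); last by ring.
apply: lerD.
  rewrite ndE// subr0 mulr1 -[leRHS]mul1r; apply: ler_pM => //.
  by rewrite ler_expR mulNr lerN2.
apply: (@le_trans _ _ (expR (- L))); last by rewrite ler_expR lerN2.
by rewrite expNL ler_pdivrMr ?ler_peMr; hlra.
Qed.

Let ln_nd v th x : 0 < v -> ln (nd v th x) = ln (peak v) - (x - th) ^+ 2 / (2 * v).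
Proof.
by move=> v0; rewrite ndE// lnM ?posrE ?peak_gt0 ?expR_gt0// expRK mulNr.
Qed.

Let g1 x : 0 < marginal1 p x.
Proof. by apply: marginal1_gt0; exact: spike_slab_point_gt0. Qed.

Let g2 x y : 0 < marginal2 p r x y.
Proof. by apply: marginal2_gt0 => //; exact: spike_slab_point_gt0. Qed.

Let marginal2_spike x y : (1 - eta) * (nd 1 0 x * nd r 0 y) <= marginal2 p r x y.
Proof.
rewrite -lee_fin EFinM muleC.
apply: (@le_trans _ _ ((nd 1 0 x * nd r 0 y)%:E * p [set 0%R])%E).
  rewrite lee_wpmul2l ?spike_slab_point// lee_fin.
  by rewrite mulr_ge0// normal_pdf_ge0.
by apply: marginal2_ge => // [|t ->//]; rewrite mulr_ge0// normal_pdf_ge0.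
Qed.

(** The logarithm is linearized by [ln u <= u - 1], since the ratio on the right has mean 1 at a
    zero coordinate: its mean cancels the [- 1] and leaves [2 * eta], which bounds [- ln (1 - eta)]
    for [eta <= 1/2]. *)
Lemma loss_spike_le x y :
  ln (nd r 0 y * marginal1 p x / marginal2 p r x y) <=
  2 * eta - 1 + marginal1 p x / nd 1 0 x.
Proof.
have n1 := nd_gt0 0 x (@ltr01 R); have n2 := nd_gt0 0 y r0.
have e1 : 0 < 1 - eta by hlra.
apply: (@le_trans _ _ (ln ((1 - eta)^-1 * (marginal1 p x / nd 1 0 x)))).
  rewrite ler_ln ?posrE ?divr_gt0 ?mulr_gt0 ?invr_gt0//.
  rewrite ler_pdivrMr//.
  have : 0 < (1 - eta)^-1 * (marginal1 p x / nd 1 0 x).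
    by rewrite mulr_gt0 ?invr_gt0// divr_gt0.
  move=> /ltW/ler_wpM2l/(_ _ _ (marginal2_spike x y)); apply: le_trans.
  rewrite le_eqVlt; apply/orP; left; apply/eqP; field.
  by rewrite !gt_eqF.
rewrite lnM ?posrE ?invr_gt0 ?divr_gt0//.
have h1 : ln (1 - eta)^-1 <= 2 * eta.
  have : (1 - eta)^-1 <= 1 + 2 * eta.
    rewrite -[leLHS]mul1r ler_pdivrMr//; have := eta0; have := eta_half; move=> ? ?; nra.
  move=> h; apply: le_trans (_ : ln (1 + 2 * eta) <= _).
    by rewrite ler_ln ?posrE ?invr_gt0//; hlra.
  by apply: le_ln1Dx; hlra.
have h2 : ln (marginal1 p x / nd 1 0 x) <= marginal1 p x / nd 1 0 x - 1.
  have q0 : 0 < marginal1 p x / nd 1 0 x by rewrite divr_gt0.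
  rewrite -[X in ln X](subrK 1) addrC; apply: le_ln1Dx; hlra.
by hlra.
Qed.

(* Case [th^2 / 2 <= L r / (1 + r)]: compare with the spike. *)
Let loss_spike_slab_near dl th x y : 0 < dl -> dl <= 1 ->
  th ^+ 2 / 2 <= r / (1 + r) * L ->
  ln (nd r th y * marginal1 p x / marginal2 p r x y) <=
  ((1 + r)^-1 + 2 * dl) * L +
    (2 * ln 2 - ln (peak 1) + (1 + dl^-1) * (x - th) ^+ 2 / 2
      + (y - th) ^+ 2 / (2 * dl * r ^+ 2)).
Proof.
move=> dl0 dl1 hL.
have L0 := L_ge0; have r0' : 0 < r := r0.
have n1 := nd_gt0 0 x (@ltr01 R); have n2 := nd_gt0 0 y r0.
have nt := nd_gt0 th y r0.
have e1 : 0 < 1 - eta by hlra.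
have r1 : 0 < 1 + r by lra.
have s1 : ln (nd r th y * marginal1 p x / marginal2 p r x y) <=
    ln 2 + (ln (nd r th y) - ln (nd r 0 y)) + (ln (marginal1 p x) - ln (nd 1 0 x)).
  have : (1 / 2) * (nd 1 0 x * nd r 0 y) <= marginal2 p r x y.
    apply: le_trans (marginal2_spike x y).
    by rewrite ler_pM2r ?mulr_gt0//; hlra.
  rewrite -ler_ln ?posrE ?mulr_gt0// !lnM ?posrE ?mulr_gt0 ?invr_gt0// ln1 lnV ?posrE//.
  by move=> ?; rewrite lnV ?posrE//; lra.
apply: le_trans s1 _.
have lm := ln_marginal1 x.
rewrite !ln_nd// subr0 mulr1 in lm *.
set m := Num.min _ _ in lm.
have mm : x ^+ 2 / 2 - m <= dl * L + (1 + dl^-1) * (x - th) ^+ 2 / 2.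
  have q0 : 0 <= (1 + dl^-1) * (x - th) ^+ 2 / 2.
    by rewrite divr_ge0// mulr_ge0 ?sqr_ge0// addr_ge0// invr_ge0 ltW.
  have q1 : 0 <= dl * L by rewrite mulr_ge0// ltW.
  rewrite /m; case: (leP (x ^+ 2 / 2) L) => _; first by lra.
  (* Young's inequality as a square: [x ^ 2 <= (1 + dl) th ^ 2 + (1 + dl^-1) (x - th) ^ 2]. The
     small weight falls on [th ^ 2], of order [L], the large one on the noise. *)
  have : 0 <= (dl * th - (x - th)) ^+ 2 / dl by rewrite divr_ge0 ?sqr_ge0// ltW.
  have -> : (dl * th - (x - th)) ^+ 2 / dl =
    (1 + dl) * th ^+ 2 + (1 + dl^-1) * (x - th) ^+ 2 - x ^+ 2.
    by field; rewrite gt_eqF.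
  have : th ^+ 2 / 2 <= L.
    apply: le_trans hL _; rewrite ler_piMl// ler_pdivrMr//; lra.
  move=> h1 h2; have : (1 + dl) * (th ^+ 2 / 2) <= (1 + dl) * L by rewrite ler_pM2l//; lra.
  by lra.
(* The leading cost: this is [th ^ 2 / (2 r)] plus the cross term [th (y - th) / r]. The first is at
   most [L / (1 + r)] by the case hypothesis, the second is split by Young with weight [dl]. *)
have yy : - ((y - th) ^+ 2 / (2 * r)) + y ^+ 2 / (2 * r) <=
   (1 + r)^-1 * L + dl * L + (y - th) ^+ 2 / (2 * dl * r ^+ 2).
  have : 0 <= (dl * th - (y - th) / r) ^+ 2 / dl by rewrite divr_ge0 ?sqr_ge0// ltW.
  have -> : (dl * th - (y - th) / r) ^+ 2 / dl = dl * th ^+ 2 - 2 * th * (y - th) / r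
      + (y - th) ^+ 2 / (dl * r ^+ 2).
    by field; rewrite !gt_eqF.
  have -> : - ((y - th) ^+ 2 / (2 * r)) + y ^+ 2 / (2 * r) =
     th ^+ 2 / 2 / r + th * (y - th) / r by field; rewrite gt_eqF.
  have -> : (y - th) ^+ 2 / (dl * r ^+ 2) = 2 * ((y - th) ^+ 2 / (2 * dl * r ^+ 2)).
    by field; rewrite !gt_eqF.
  have h3 : th ^+ 2 / 2 / r <= (1 + r)^-1 * L.
    rewrite ler_pdivrMr//; apply: le_trans hL _.
    by rewrite le_eqVlt; apply/orP; left; apply/eqP; field; rewrite gt_eqF.
  have : th ^+ 2 / 2 <= L.
    apply: le_trans hL _; rewrite ler_piMl// ler_pdivrMr//; lra.
  move=> h1 h2; have : dl * (th ^+ 2 / 2) <= dl * L by rewrite ler_pM2l//; lra.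
  by lra.
by lra.
Qed.

(* Case [th^2 / 2 >= L r / (1 + r)]: compare with the slab near [th]. *)
Let loss_spike_slab_far dl th x y : 0 < dl -> dl <= 1 -> `|th| <= l ->
  r / (1 + r) * L <= th ^+ 2 / 2 ->
  ln (nd r th y * marginal1 p x / marginal2 p r x y) <=
  ((1 + r)^-1 + dl) * L + ln l +
    (2 * ln 2 - ln (peak 1) + 1 + r^-1 + (1 + dl^-1) * (x - th) ^+ 2
      + (y - th) ^+ 2 / r).
Proof.
move=> dl0 dl1 thl hL.
have L0 := L_ge0; have r0' : 0 < r := r0.
have nt := nd_gt0 th y r0.
have r1 : 0 < 1 + r by lra.
have l0 : 0 < l by hlra.
pose c := peak 1 * peak r * expR (- ((x - th) ^+ 2 + 1) - ((y - th) ^+ 2 + 1) / r).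
have c0 : 0 < c by rewrite mulr_gt0 ?expR_gt0// mulr_gt0// peak_gt0.
(* Uniform in [u] within distance 1 of [th], from [(a - u) ^ 2 <= 2 (a - th) ^ 2 + 2]. *)
have ndb v a u : 0 < v -> `|u - th| <= 1 ->
    peak v * expR (- (((a - th) ^+ 2 + 1) / v)) <= nd v u a.
  move=> v0 u1; rewrite ndE// ler_pM2l ?peak_gt0// ler_expR -mulNr.
  rewrite (_ : (- (a - u) ^+ 2) / (2 * v) = (- (a - u) ^+ 2 / 2) / v); last first.
    by field; rewrite gt_eqF.
  rewrite ler_pM2r ?invr_gt0//.
  have : (u - th) ^+ 2 <= 1 by rewrite -real_normK ?num_real// expr_le1.
  by have := sqr_ge0 ((a - th) + (u - th)); nra.
have m2 : eta / (2 * l) * c <= marginal2 p r x y.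
  (* The unit interval with endpoint [th] extends towards 0, so it stays inside [[-l, l]] even for
     [th] at the boundary. *)
  pose a := if th <= 0 then th else th - 1.
  have al : - l <= a /\ a + 1 <= l.
    move: thl; rewrite ler_norml => /andP[h1 h2]; have := l2; move=> ?.
    by rewrite /a; case: (leP th 0) => ?; split; lra.
  rewrite -lee_fin EFinM muleC.
  apply: (@le_trans _ _ (c%:E * p `[a, (a + 1)%R]%classic)%E).
    rewrite lee_wpmul2l ?lee_fin ?(ltW c0)//.
    by apply: spike_slab_itv; case: al.
  apply: marginal2_ge => //; first exact: ltW.
  move=> u /=; rewrite in_itv/= => /andP[u1 u2].
  have ut : `|u - th| <= 1.
    by rewrite ler_norml; apply/andP; move: u1 u2; rewrite /a; case: (leP th 0) => ? ? ?; split; lra.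
  apply: le_trans (ler_pM _ _ (ndb _ x u ltr01 ut) (ndb _ y u r0 ut)).
  - by rewrite /c divr1 expRD le_eqVlt; apply/orP; left; apply/eqP; ring.
  - by rewrite mulr_ge0 ?expR_ge0// ltW// peak_gt0.
  - by rewrite mulr_ge0 ?expR_ge0// ltW// peak_gt0.
have e2 : 0 < eta / (2 * l) by rewrite divr_gt0// mulr_gt0.
have lm := ln_marginal1 x.
have lm2 : - L - ln 2 - ln l + (ln (peak 1) + ln (peak r)
    + (- ((x - th) ^+ 2 + 1) - ((y - th) ^+ 2 + 1) / r)) <= ln (marginal2 p r x y).
  have pp : 0 < peak 1 * peak r by rewrite mulr_gt0// peak_gt0.
  have lnc : ln c = ln (peak 1) + ln (peak r)
      + (- ((x - th) ^+ 2 + 1) - ((y - th) ^+ 2 + 1) / r).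
    by rewrite /c lnM ?posrE ?expR_gt0// expRK lnM ?posrE ?peak_gt0.
  have lne2 : ln (eta / (2 * l)) = - L - ln 2 - ln l.
    rewrite lnM ?posrE ?invr_gt0 ?mulr_gt0// lnV ?posrE ?mulr_gt0// lnM ?posrE//.
    by rewrite /L lnV ?posrE//; ring.
  have : ln (eta / (2 * l) * c) <= ln (marginal2 p r x y).
    by rewrite ler_ln ?posrE// mulr_gt0.
  by rewrite lnM ?posrE// lne2 lnc.
have ln1 : ln (nd r th y) <= ln (peak r).
  rewrite ln_nd// gerBl divr_ge0 ?sqr_ge0//; lra.
(* The amount gained back from [marginal1]: Young again, now with [th ^ 2 / 2] bounded below.
   Subtracted from the slab cost [L], it leaves [((1 + r)^-1 + dl) L]. *)
have mm : (r / (1 + r) - dl) * L - dl^-1 * (x - th) ^+ 2 <= Num.min (x ^+ 2 / 2) L.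
  have q0 : 0 <= dl^-1 * (x - th) ^+ 2 by rewrite mulr_ge0 ?sqr_ge0// invr_ge0 ltW.
  have q1 : 0 <= dl * L by rewrite mulr_ge0// ltW.
  have q2 : r / (1 + r) * L <= L.
    rewrite ler_piMl// ler_pdivrMr//; lra.
  rewrite le_min; apply/andP; split; last by lra.
  have : 0 <= (dl * th + (x - th)) ^+ 2 / dl by rewrite divr_ge0 ?sqr_ge0// ltW.
  have -> : (dl * th + (x - th)) ^+ 2 / dl =
    x ^+ 2 - (1 - dl) * th ^+ 2 + (dl^-1 - 1) * (x - th) ^+ 2.
    by field; rewrite gt_eqF.
  have h1 : (1 - dl) * (r / (1 + r) * L) <= (1 - dl) * (th ^+ 2 / 2).
    by rewrite ler_wpM2l//; lra.
  have h2 : dl * (r / (1 + r) * L) <= dl * L by rewrite ler_wpM2l// ltW.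
  have h3 := sqr_ge0 (x - th).
  by lra.
rewrite !lnM ?posrE ?mulr_gt0 ?invr_gt0// lnV ?posrE//.
have -> : (1 + r)^-1 = 1 - r / (1 + r) by field; rewrite gt_eqF.
rewrite (mulrDl ((y - th) ^+ 2)) mul1r in lm2.
by lra.
Qed.

Let peak_const_ge0 : 0 <= 2 * ln 2 - ln (peak 1).
Proof.
have : ln (peak 1) <= 0 by apply: ln_le0.
have : 0 <= ln (2 : R) by rewrite ln_ge0// ler1n.
lra.
Qed.

Lemma loss_const_ge0 dl : 0 < dl -> 0 <= loss_const r dl.
Proof.
move=> dl0; rewrite /loss_const -/(peak 1).
have pc := peak_const_ge0.
have i1 : 0 < r^-1 by rewrite invr_gt0.
have i2 : 0 < dl^-1 by rewrite invr_gt0.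
have i3 : 0 < (2 * dl * r ^+ 2)^-1 by rewrite invr_gt0 !mulr_gt0// exprn_gt0.
lra.
Qed.

Lemma loss_spike_slab_le dl th x y : 0 < dl -> dl <= 1 -> `|th| <= l ->
  ln (nd r th y * marginal1 p x / marginal2 p r x y) <=
  ((1 + r)^-1 + 2 * dl) * L + ln l +
    loss_const r dl * (1 + (x - th) ^+ 2 + (y - th) ^+ 2).
Proof.
move=> dl0 dl1 thl.
have ln0 : 0 <= ln l by apply: ln_ge0; hlra.
have X0 := sqr_ge0 (x - th); have Y0 := sqr_ge0 (y - th).
have pc := peak_const_ge0.
have i1 : 0 < r^-1 by rewrite invr_gt0.
have i2 : 0 < dl^-1 by rewrite invr_gt0.
have i3 : 0 < (2 * dl * r ^+ 2)^-1 by rewrite invr_gt0 !mulr_gt0// exprn_gt0.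
have L0 := L_ge0.
have dL0 : 0 <= dl * L by rewrite mulr_ge0// ltW.
rewrite /loss_const -/(peak 1).
set K := _ + (2 * dl * r ^+ 2)^-1.
have KX : (1 + dl^-1) * (x - th) ^+ 2 <= K * (x - th) ^+ 2.
  by rewrite ler_wpM2r// /K; lra.
have KY1 : r^-1 * (y - th) ^+ 2 <= K * (y - th) ^+ 2.
  by rewrite ler_wpM2r// /K; lra.
have KY2 : (2 * dl * r ^+ 2)^-1 * (y - th) ^+ 2 <= K * (y - th) ^+ 2.
  by rewrite ler_wpM2r// /K; lra.
have X1 : 0 <= (1 + dl^-1) * (x - th) ^+ 2 by rewrite mulr_ge0//; lra.
have [h|/ltW h] := leP (th ^+ 2 / 2) (r / (1 + r) * L).
  apply: le_trans (loss_spike_slab_near x y dl0 dl1 h) _.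
  by rewrite /K in KX KY2 *; lra.
apply: le_trans (loss_spike_slab_far x y dl0 dl1 thl h) _.
by rewrite /K in KX KY1 *; lra.
Qed.

End spike_slab_bounds.

(** * Upper bound *)

Lemma ln_prod (R : realType) (I : Type) (s : seq I) (F : I -> R) :
  (forall i, 0 < F i) -> ln (\prod_(i <- s) F i) = \sum_(i <- s) ln (F i).
Proof.
move=> F0; elim: s => [|i s IH]; first by rewrite !big_nil ln1.
by rewrite !big_cons lnM ?posrE ?IH// prodr_gt0.
Qed.

Lemma lne_gaussian_div (R : realType) n r (th y : vec R n) (q : R) : 0 < r -> 0 < q ->
  lne ((gaussian_pdf th r y)%:E / q%:E)%E = (ln (gaussian_pdf th r y / q))%:E.
Proof.
move=> r0 q0; rewrite inver (gt_eqF q0) -EFinM lne_EFin// divr_gt0//.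
exact: gaussian_pdf_gt0.
Qed.

Section upper_bound.
Context {R : realType} {n : nat}.
Variables (eta l r dl : R).
Hypotheses (eta0 : 0 < eta) (eta_half : eta <= 2^-1) (l2 : 2 <= l) (r0 : 0 < r).
Hypotheses (dl0 : 0 < dl) (dl1 : dl <= 1).
Notation p := (spike_slab eta l).
Notation K := (loss_const r dl).
Notation a1 := (((1 + r)^-1 + 2 * dl) * ln eta^-1 + ln l).

Let m1_gt0 x : 0 < marginal1 p x.
Proof. by apply: marginal1_gt0; exact: (spike_slab_point_gt0 eta0 eta_half l2). Qed.

Let m2_gt0 x y : 0 < marginal2 p r x y.
Proof. by apply: marginal2_gt0 => //; exact: (spike_slab_point_gt0 eta0 eta_half l2). Qed.

Let K0 : 0 <= K. Proof. exact: loss_const_ge0. Qed.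

Let a1_ge0 : 0 <= a1.
Proof.
have e0 := eta0; have eh := eta_half; have l2' := l2; have r0' := r0; have dl0' := dl0.
have i : 0 < (1 + r)^-1 by rewrite invr_gt0; lra.
apply: addr_ge0; last by apply: ln_ge0; lra.
apply: mulr_ge0; first lra.
by apply: ln_ge0; rewrite invf_ge1//; lra.
Qed.

Section coordinate.
Variables (th : vec R n) (i : 'I_n).
Notation E := (joint_expect r th).

Lemma joint_expect_sqr :
  (E (fun z => ((tnth z.1 i - tnth th i) ^+ 2 + (tnth z.2 i - tnth th i) ^+ 2)%R)
    <= (8 + 8 * r)%:E)%E.
Proof.
have msq : measurable_fun [set: measurableTypeR R]
    (fun a : measurableTypeR R => (a - tnth th i) ^+ 2 : R).
  by apply: measurable_funX; exact: measurable_funB.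
have mc : measurable_fun [set: measurableTypeR R] (fun _ : measurableTypeR R => 1 : R).
  exact: measurable_cst.
have sq0 (a : measurableTypeR R) : 0 <= (a - tnth th i) ^+ 2 :> R by exact: sqr_ge0.
have int1 v : 0 < v -> (\int[@lebesgue_measure R]_a (nd v (tnth th i) a * 1)%:E = 1)%E.
  by move=> v0; under eq_integral do rewrite mulr1; exact: integral_nd.
rewrite joint_expectD//; last 2 first.
- exact: (measurableT_comp msq (measurableT_comp (measurable_tnth i) measurable_fst)).
- exact: (measurableT_comp msq (measurableT_comp (measurable_tnth i) measurable_snd)).
have -> : E (fun z => ((tnth z.1 i - tnth th i) ^+ 2)%R) =
    E (fun z => (((tnth z.1 i - tnth th i) ^+ 2) * 1)%R).
  by congr joint_expect; apply/funext => z; rewrite mulr1.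
have -> : E (fun z => ((tnth z.2 i - tnth th i) ^+ 2)%R) =
    E (fun z => (1 * ((tnth z.2 i - tnth th i) ^+ 2))%R).
  by congr joint_expect; apply/funext => z; rewrite mul1r.
rewrite (joint_expect_coord th r0 i msq mc)// (joint_expect_coord th r0 i mc msq)//.
rewrite !int1// mule1 mul1e EFinD; apply: leeD; last exact: nd_sqr_int.
by apply: le_trans (nd_sqr_int _ (@ltr01 R)) _; rewrite mulr1.
Qed.

(** The denominator cancels the true density of the coordinate, leaving the total mass of
    [marginal1]. *)
Lemma joint_expect_marginal_ratio : tnth th i = 0 ->
  (E (fun z => (marginal1 p (tnth z.1 i) / nd 1 0 (tnth z.1 i))%R) = 1)%E.
Proof.
move=> thi.
have mq : measurable_fun [set: measurableTypeR R]
    (fun a : measurableTypeR R => marginal1 p a / nd 1 0 a).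
  apply: measurable_funM; first exact: measurable_marginal1.
  by apply: measurable_inv_pos; [exact: measurable_nd|move=> a; exact: nd_gt0].
have mc : measurable_fun [set: measurableTypeR R] (fun _ : measurableTypeR R => 1 : R).
  exact: measurable_cst.
have q0 (a : measurableTypeR R) : 0 <= marginal1 p a / nd 1 0 a :> R.
  by rewrite divr_ge0// ?normal_pdf_ge0// ltW.
have -> : E (fun z => (marginal1 p (tnth z.1 i) / nd 1 0 (tnth z.1 i))%R) =
    E (fun z => (marginal1 p (tnth z.1 i) / nd 1 0 (tnth z.1 i) * 1)%R).
  by congr joint_expect; apply/funext => z; rewrite mulr1.
rewrite (joint_expect_coord th r0 i mq mc)// thi.
under [X in (_ * X)%E]eq_integral do rewrite mulr1.
rewrite integral_nd// mule1 -[RHS](integral_marginal1 p).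
by apply: eq_integral => a _; congr EFin; rewrite mulrC divfK// gt_eqF// nd_gt0.
Qed.

End coordinate.

(** The loss of coordinate [i] is at most [Ai + Bi], with [Ai] deterministic and [Bi] nonnegative,
    the form that [risk_le] takes. *)
Let Bi (th : vec R n) i (z : vec R n * vec R n) : R :=
  if tnth th i == 0 then marginal1 p (tnth z.1 i) / nd 1 0 (tnth z.1 i)
  else K * ((tnth z.1 i - tnth th i) ^+ 2 + (tnth z.2 i - tnth th i) ^+ 2).

Let Ai (th : vec R n) i : R := if tnth th i == 0 then 2 * eta - 1 else a1 + K.

Let mBsq (th : vec R n) i : measurable_fun [set: vec R n * vec R n]
  (fun z => (tnth z.1 i - tnth th i) ^+ 2 + (tnth z.2 i - tnth th i) ^+ 2 : R).
Proof.
apply: measurable_funD; apply: measurable_funX; apply: measurable_funB => //.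
  exact: (measurableT_comp (measurable_tnth i) measurable_fst).
exact: (measurableT_comp (measurable_tnth i) measurable_snd).
Qed.

Let mBi th i : measurable_fun setT (Bi th i).
Proof.
rewrite /Bi; case: (tnth th i == 0); last exact: measurable_funM.
have mq : measurable_fun [set: measurableTypeR R]
    (fun a : measurableTypeR R => marginal1 p a / nd 1 0 a).
  apply: measurable_funM; first exact: measurable_marginal1.
  by apply: measurable_inv_pos; [exact: measurable_nd|move=> a; exact: nd_gt0].
exact: (measurableT_comp mq (measurableT_comp (measurable_tnth i) measurable_fst)).
Qed.

Let Bi_ge0 th i z : 0 <= Bi th i z.
Proof.
rewrite /Bi; case: ifP => _; first by rewrite divr_ge0 ?normal_pdf_ge0// ltW.
by rewrite mulr_ge0// addr_ge0// sqr_ge0.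
Qed.

Lemma risk_spike_slab_le (s : nat) (th : vec R n) : sparse_box n s l th ->
  (risk r th (spike_slab_predictive r eta l) <=
   (n%:R * (2 * eta) + s%:R * (a1 + K * (9 + 8 * r)))%:E)%E.
Proof.
move=> [ths thl].
have q0 : 0 <= a1 + K * (9 + 8 * r).
  by rewrite addr_ge0// mulr_ge0// addr_ge0// mulr_ge0// ltW.
apply: (@le_trans _ _ ((\sum_(i < n) Ai th i)%:E +
    joint_expect r th (fun z => \sum_(i < n) Bi th i z)%R)%E).
  apply: risk_le => //.
  - by apply: measurable_sum => i; exact: mBi.
  - by move=> z; apply: sumr_ge0 => i _; exact: Bi_ge0.
  - move=> x y; rewrite /spike_slab_predictive bayes_predictiveE//; last first.
      exact: (spike_slab_point_gt0 eta0 eta_half l2).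
    rewrite lne_gaussian_div//; last first.
      by apply: prodr_gt0 => i _; rewrite divr_gt0.
    rewrite /gaussian_pdf -prodf_div ln_prod; last first.
      by move=> i; rewrite !divr_gt0// nd_gt0.
    rewrite lee_fin -big_split/=; apply: ler_sum => i _.
    rewrite invf_div mulrA /Ai /Bi; case: ifPn => [/eqP ->|_].
      exact: loss_spike_le.
    apply: le_trans (loss_spike_slab_le eta0 eta_half l2 r0 _ _ dl0 dl1 (thl i)) _.
    by rewrite le_eqVlt; apply/orP; left; apply/eqP; ring.
rewrite joint_expect_sum//= -sumEFin -big_split/=.
(* The term [2 * eta] is charged to every coordinate, nonzero ones included, so that it sums to
   [n * (2 * eta)]. The [9 + 8 r] is 1 from [Ai] plus [8 + 8 r] from the second moments. *)
apply: (@le_trans _ _ (\sum_(i < n)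
    (2 * eta + (tnth th i != 0)%:R * (a1 + K * (9 + 8 * r)))%:E)%E).
  apply: lee_sum => i _; rewrite /Ai /Bi; case: ifPn => [/eqP thi|thi].
    rewrite joint_expect_marginal_ratio// -EFinD lee_fin mul0r addr0 subrK//.
  rewrite joint_expectZ//; last first.
    by move=> z; rewrite addr_ge0// sqr_ge0.
  apply: (@le_trans _ _ ((a1 + K)%:E + K%:E * (8 + 8 * r)%:E)%E).
    by rewrite leeD2l// lee_wpmul2l ?lee_fin//; exact: joint_expect_sqr.
  rewrite -EFinM -EFinD lee_fin mul1r; have := eta0; lra.
rewrite sumEFin lee_fin big_split/= sumr_const card_ord -(mulr_natl (2 * eta) n).
rewrite lerD2l -mulr_suml ler_wpM2r// -natr_sum ler_nat.
by rewrite -sum1_card big_mkcond in ths.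
Qed.

End upper_bound.

(** * Lower bound *)

Section lower_bound.
Context {R : realType} {n : nat}.
Variables (s m : nat) (r lam : R).
Hypotheses (m0 : (0 < m)%N) (smn : (s * m <= n)%N) (r0 : 0 < r) (lam0 : 0 <= lam).
(** The left side is the mean log likelihood ratio, over both observations, at a true spike.
    Equality with [ln m] puts the spike at the threshold for being located among [m] positions. *)
Hypothesis lamE : lam ^+ 2 / 2 * (1 + r^-1) = ln m%:R.
Implicit Types (b : 'I_s) (k : 'I_m) (i : 'I_n) (j : {ffun 'I_s -> 'I_m}).
Implicit Types (x y : vec R n) (z : vec R n * vec R n).

Let idx_subproof b k : (b * m + k < n)%N.
Proof.
apply: leq_trans smn; apply: (@leq_trans (b.+1 * m)); last by rewrite leq_mul2r ltn_ord orbT.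
by rewrite mulSn addnC ltn_add2r.
Qed.

Definition block_index b k : 'I_n := Ordinal (idx_subproof b k).

Lemma block_index_inj b k b' k' : block_index b k = block_index b' k' -> b = b' /\ k = k'.
Proof.
move=> /(congr1 val) /= h; split; apply/val_inj => /=.
  by have := congr1 (divn^~ m) h; rewrite !divnMDl// !divn_small// !addn0.
by have := congr1 (modn^~ m) h; rewrite !modnMDl !modn_small.
Qed.

Definition spikes j : {set 'I_n} := [set block_index b (j b) | b in 'I_s].

Lemma spikesE j b k : (block_index b k \in spikes j) = (k == j b).
Proof.
apply/imsetP/eqP => [[b' _ /block_index_inj[-> ->]]//|->].
by exists b.
Qed.

Definition spike_vec j : vec R n := [tuple if i \in spikes j then lam else 0 | i < n].

Lemma tnth_spike_vec j i : tnth (spike_vec j) i = if i \in spikes j then lam else 0.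
Proof. by rewrite tnth_mktuple. Qed.

Lemma spike_vec_sparse j (t : R) : lam <= t -> sparse_box n s t (spike_vec j).
Proof.
move=> lt; split => [|i].
  apply: (@leq_trans #|spikes j|).
    apply: subset_leq_card; apply/fintype.subsetP => i; rewrite inE tnth_spike_vec.
    by case: ifP => //; rewrite eqxx.
  by apply: leq_trans (leq_imset_card _ _) _; rewrite card_ord.
rewrite tnth_spike_vec; case: ifP => _; first by rewrite ger0_norm.
by rewrite normr0; exact: le_trans lt.
Qed.

Lemma sum_spikes j (F : 'I_n -> R) :
  \sum_(i in spikes j) F i = \sum_(b < s) F (block_index b (j b)).
Proof. by rewrite big_imset//= => b b' _ _ /block_index_inj[]. Qed.

Definition lik_ratio i z : R :=
  (nd 1 lam (tnth z.1 i) / nd 1 0 (tnth z.1 i)) * (nd r lam (tnth z.2 i) / nd r 0 (tnth z.2 i)).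

Lemma lik_ratio_gt0 i z : 0 < lik_ratio i z.
Proof. by rewrite mulr_gt0// divr_gt0// nd_gt0. Qed.

Let mrat v : 0 < v ->
  measurable_fun [set: measurableTypeR R] (fun a : measurableTypeR R => nd v lam a / nd v 0 a : R).
Proof.
move=> v0; apply: measurable_funM; first exact: measurable_nd.
by apply: measurable_inv_pos; [exact: measurable_nd|move=> a; exact: nd_gt0].
Qed.

Lemma measurable_lik_ratio i : measurable_fun setT (lik_ratio i).
Proof.
apply: measurable_funM.
  exact: (measurableT_comp (mrat ltr01) (measurableT_comp (measurable_tnth i) measurable_fst)).
exact: (measurableT_comp (mrat r0) (measurableT_comp (measurable_tnth i) measurable_snd)).
Qed.

Lemma joint_expect_lik_ratio th i : tnth th i = 0 ->
  joint_expect r th (lik_ratio i) = 1%E.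
Proof.
move=> thi; have rat0 v (a : measurableTypeR R) : 0 <= nd v lam a / nd v 0 a :> R.
  by rewrite divr_ge0// normal_pdf_ge0.
rewrite (joint_expect_coord th r0 i (mrat ltr01) (mrat r0))// thi.
have int v : 0 < v ->
    (\int[@lebesgue_measure R]_a (nd v 0 a * (nd v lam a / nd v 0 a))%:E = 1)%E.
  move=> v0; rewrite -[RHS](integral_nd lam v0); apply: eq_integral => a _.
  by rewrite mulrC divfK// gt_eqF// nd_gt0.
by rewrite !int// mule1.
Qed.

Definition block_sum b z : R := \sum_(k < m) lik_ratio (block_index b k) z.

Lemma block_sum_gt0 b z : 0 < block_sum b z.
Proof.
rewrite /block_sum (bigD1 (Ordinal m0))//= ltr_pwDl ?lik_ratio_gt0//.
by apply: sumr_ge0 => k _; rewrite ltW// lik_ratio_gt0.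
Qed.

(** The prior probability of [j] is [m ^ (- s)], and the blocks are independent; hence one factor
    [m] per block. *)
Definition posterior_ratio j z : R :=
  \prod_(b < s) (m%:R * lik_ratio (block_index b (j b)) z / block_sum b z).

Let mR0 : 0 < m%:R :> R. Proof. by rewrite ltr0n. Qed.

Lemma posterior_ratio_gt0 j z : 0 < posterior_ratio j z.
Proof.
by apply: prodr_gt0 => b _; rewrite divr_gt0 ?block_sum_gt0// mulr_gt0// lik_ratio_gt0.
Qed.

Lemma measurable_posterior_ratio j : measurable_fun setT (posterior_ratio j).
Proof.
apply: measurable_prod => b _; apply: measurable_funM.
  by apply: measurable_funM => //; exact: measurable_lik_ratio.
apply: measurable_inv_pos; last by move=> z; exact: block_sum_gt0.
by apply: measurable_sum => k; exact: measurable_lik_ratio.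
Qed.

(** A sum of products over all choice functions is the product of the block sums, each equal to
    [m]. *)
Lemma sum_posterior_ratio z :
  \sum_(j : {ffun 'I_s -> 'I_m}) posterior_ratio j z = (m ^ s)%:R.
Proof.
rewrite /posterior_ratio -(bigA_distr_bigA
  (fun b k => m%:R * lik_ratio (block_index b k) z / block_sum b z)).
rewrite (eq_bigr (fun=> m%:R)) ?prodr_const ?card_ord ?natrX// => b _.
rewrite -mulr_suml -mulr_sumr -/(block_sum b z) mulfK// gt_eqF//.
exact: block_sum_gt0.
Qed.

(** With [X], [Y] the deviations of the two observations from [lam], the linear terms met below are
    at most [2 lam |X| + lam |Y| / r]; [kap] dominates both coefficients. *)
Notation kap := ((2 + r^-1) * lam).

Let noise j b z : R :=
  kap * ((tnth z.1 (block_index b (j b)) - lam) ^+ 2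
         + (tnth z.2 (block_index b (j b)) - lam) ^+ 2)
  + m%:R^-1 * \sum_(k < m | k != j b) lik_ratio (block_index b k) z.

Let kap0 : 0 <= kap.
Proof. by rewrite mulr_ge0// addr_ge0// invr_ge0 ltW. Qed.

(* The other [m - 1] likelihood ratios of the block have mean 1 each, so their
   sum is replaced by [m] at the cost of the last term of [noise]. *)
Let ln_block_ge j b z (i := block_index b (j b)) :
  ln m%:R - ln 2 - lam ^+ 2 / 2 - kap - noise j b z <=
  ln (m%:R * lik_ratio i z / block_sum b z) - ln (nd 1 lam (tnth z.1 i) / nd 1 0 (tnth z.1 i)).
Proof.
have r0' := r0; have l0 := lam0; have ri : 0 < r^-1 by rewrite invr_gt0.
have g0 := lik_ratio_gt0 i z.
set X := tnth z.1 i - lam; set Y := tnth z.2 i - lam.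
have lngE : ln (lik_ratio i z) = ln m%:R + lam * X + lam * Y * r^-1.
  rewrite /lik_ratio lnM ?posrE ?divr_gt0 ?nd_gt0// !ln_nd_ratio// -lamE /X /Y.
  by field; rewrite gt_eqF.
set S' := \sum_(k < m | k != j b) lik_ratio (block_index b k) z.
have S0 : 0 <= S' by apply: sumr_ge0 => k _; rewrite ltW// lik_ratio_gt0.
have bsE : block_sum b z = lik_ratio i z + S' by rewrite /block_sum (bigD1 (j b)).
(* From [g + S' <= (g + m) (1 + S' / m)] and [ln (1 + u) <= u]: the competing ratios leave the
   logarithm and enter linearly, where their mean is known. *)
have bs_le : ln (block_sum b z) <= ln (lik_ratio i z + m%:R) + m%:R^-1 * S'.
  have h : 0 < 1 + m%:R^-1 * S' by rewrite ltr_pwDl// mulr_ge0// invr_ge0 ltW.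
  have gm : 0 < lik_ratio i z + m%:R by rewrite addr_gt0.
  apply: (@le_trans _ _ (ln ((lik_ratio i z + m%:R) * (1 + m%:R^-1 * S')))).
    rewrite bsE ler_ln ?posrE ?mulr_gt0//; last by rewrite ltr_pwDl.
    have -> : (lik_ratio i z + m%:R) * (1 + m%:R^-1 * S') =
      lik_ratio i z + S' + (m%:R + lik_ratio i z * (m%:R^-1 * S')).
      by field; rewrite gt_eqF.
    by rewrite lerDl addr_ge0 ?(ltW mR0)// mulr_ge0 ?(ltW g0)// mulr_ge0// invr_ge0 ltW.
  rewrite lnM ?posrE// lerD2l; apply: le_ln1Dx.
  by rewrite (lt_le_trans (ltrN10 R))// mulr_ge0// invr_ge0 ltW.
have absX : `|X| <= 1 + X ^+ 2.
  by rewrite ler_norml; apply/andP; split; have := sqr_ge0 (X - 1); have := sqr_ge0 (X + 1); nra.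
have absY : `|Y| <= 1 + Y ^+ 2.
  by rewrite ler_norml; apply/andP; split; have := sqr_ge0 (Y - 1); have := sqr_ge0 (Y + 1); nra.
have e_le : ln (lik_ratio i z + m%:R) <= ln 2 + Num.max (ln (lik_ratio i z)) (ln m%:R).
  set M := Num.max _ _.
  rewrite -[leRHS]expRK ler_ln ?posrE ?expR_gt0 ?addr_gt0// expRD lnK ?posrE//.
  rewrite mulr_natl mulr2n; apply: lerD.
    by rewrite -[leLHS]lnK ?posrE// ler_expR le_max lexx.
  by rewrite -[leLHS]lnK ?posrE// ler_expR le_max lexx orbT.
(* By [lngE] the two logarithms differ only by the linear fluctuation. *)
have max_le : Num.max (ln (lik_ratio i z)) (ln m%:R) <=
    ln (lik_ratio i z) + lam * `|X| + lam * `|Y| * r^-1.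
  have h1 : 0 <= lam * X + lam * `|X|.
    rewrite -mulrDr mulr_ge0//; have := ler_norm (- X); rewrite normrN; lra.
  have h2 : 0 <= lam * Y * r^-1 + lam * `|Y| * r^-1.
    rewrite -mulrDl -mulrDr; apply: mulr_ge0; last exact: ltW.
    rewrite mulr_ge0//; have := ler_norm (- Y); rewrite normrN; lra.
  have h3 : 0 <= lam * `|X| by rewrite mulr_ge0.
  have h4 : 0 <= lam * `|Y| * r^-1 by rewrite mulr_ge0// ?mulr_ge0// ltW.
  by rewrite ge_max; apply/andP; split; rewrite lngE; lra.
have hX : lam * `|X| <= lam * (1 + X ^+ 2) by rewrite ler_wpM2l.
have hX' : lam * X <= lam * `|X| by rewrite ler_wpM2l// ler_norm.
have hY : lam * `|Y| * r^-1 <= lam * (1 + Y ^+ 2) * r^-1.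
  by rewrite ler_wpM2r ?(ltW ri)// ler_wpM2l.
have p1 : 0 <= lam * X ^+ 2 * r^-1 by rewrite mulr_ge0 ?(ltW ri)// mulr_ge0// sqr_ge0.
have p2 : 0 <= lam * Y ^+ 2 by rewrite mulr_ge0// sqr_ge0.
have -> : ln (m%:R * lik_ratio i z / block_sum b z) =
    ln m%:R + ln (lik_ratio i z) - ln (block_sum b z).
  have b0 := block_sum_gt0 b z.
  have mg0 : 0 < m%:R * lik_ratio i z by rewrite mulr_gt0.
  by rewrite ln_div ?posrE// lnM ?posrE.
rewrite ln_nd_ratio// -/X divr1 mulr1 /noise -/i -/X -/Y -/S'.
by lra.
Qed.

(** * Comparison with an arbitrary predictive density *)

Variable q : vec R n -> vec R n -> R.
Hypothesis q_density : predictive_density q.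

Let p0 x : R := gaussian_pdf [tuple 0 | _ < n] 1 x.

(** This is [G / u] for the [j]-th configuration. Its denominator is the joint density under that
    configuration, so its expectation is the integral of [p0 q G]. *)
Let tilt j z : R := p0 z.1 * q z.1 z.2 * posterior_ratio j z /
  (gaussian_pdf (spike_vec j) 1 z.1 * gaussian_pdf (spike_vec j) r z.2).

Let ln_lik_x j x : ln (gaussian_pdf (spike_vec j) 1 x / p0 x) =
  \sum_(b < s) ln (nd 1 lam (tnth x (block_index b (j b))) / nd 1 0 (tnth x (block_index b (j b)))).
Proof.
rewrite /p0 /gaussian_pdf -prodf_div ln_prod; last by move=> i; rewrite divr_gt0// nd_gt0.
rewrite -(sum_spikes j (fun i => ln (nd 1 lam (tnth x i) / nd 1 0 (tnth x i)))).
rewrite [RHS]big_mkcond/=; apply: eq_bigr => i _.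
rewrite tnth_spike_vec tnth_mktuple; case: ifP => // _.
by rewrite divff ?ln1// gt_eqF// nd_gt0.
Qed.

Let loss_ge j x y :
  ((s%:R * (ln m%:R - ln 2 - lam ^+ 2 / 2 - kap) + 1 -
    (\sum_(b < s) noise j b (x, y) + tilt j (x, y)))%:E <=
  lne ((gaussian_pdf (spike_vec j) r y)%:E / (q x y)%:E))%E.
Proof.
have [_ q_ge0 _] := q_density.
have gy := gaussian_pdf_gt0 (spike_vec j) y r0.
have gx := gaussian_pdf_gt0 (spike_vec j) x (@ltr01 R).
have g0 : 0 < p0 x by exact: gaussian_pdf_gt0.
(* Where [q] vanishes the loss is [+oo]. *)
have := q_ge0 x y; rewrite le_eqVlt => /predU1P[<-|q_gt0].
  by rewrite inve0 gt0_muley ?lte_fin//= leey.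
rewrite lne_gaussian_div// lee_fin.
have G0 := posterior_ratio_gt0 j (x, y).
set G := posterior_ratio j (x, y) in G0 *.
set u := gaussian_pdf (spike_vec j) r y / q x y.
set a := gaussian_pdf (spike_vec j) 1 x / p0 x.
have u0 : 0 < u by rewrite divr_gt0.
have a0 : 0 < a by rewrite divr_gt0.
have tE : tilt j (x, y) = G / (a * u).
  by rewrite /tilt /= -/G /a /u; field; rewrite !gt_eqF.
have t0 : 0 < G / (a * u) by rewrite divr_gt0// mulr_gt0.
have h1 : ln (G / (a * u)) <= G / (a * u) - 1.
  rewrite -[X in ln X](subrK 1) addrC; apply: le_ln1Dx; lra.
have lnE : ln (G / (a * u)) = ln G - (ln a + ln u).
  have au0 : 0 < a * u by rewrite mulr_gt0.
  by rewrite ln_div ?posrE// lnM ?posrE.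
rewrite lnE in h1.
have h2 : s%:R * (ln m%:R - ln 2 - lam ^+ 2 / 2 - kap) - \sum_(b < s) noise j b (x, y)
    <= ln G - ln a.
  rewrite /G /posterior_ratio ln_prod; last first.
    by move=> b; rewrite divr_gt0 ?block_sum_gt0// mulr_gt0// lik_ratio_gt0.
  rewrite /a ln_lik_x -sumrB.
  rewrite -[X in X%:R](card_ord s) -sum1_card natr_sum mulr_suml -sumrB.
  by apply: ler_sum => b _; rewrite mul1r; exact: ln_block_ge.
rewrite tE; lra.
Qed.

Let m_noise j b : measurable_fun setT (noise j b).
Proof.
apply: measurable_funD; apply: measurable_funM => //.
  apply: measurable_funD; apply: measurable_funX; apply: measurable_funB => //.
    exact: (measurableT_comp (measurable_tnth _) measurable_fst).
  exact: (measurableT_comp (measurable_tnth _) measurable_snd).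
rewrite (_ : (fun z => _) = fun z => \sum_(k < m)
    (if k != j b then lik_ratio (block_index b k) z else 0)); last first.
  by apply/funext => z; rewrite big_mkcond.
by apply: measurable_sum => k; case: (k != j b) => //; exact: measurable_lik_ratio.
Qed.

Let noise_ge0 j b z : 0 <= noise j b z.
Proof.
apply: addr_ge0; first by rewrite mulr_ge0// addr_ge0// sqr_ge0.
rewrite mulr_ge0 ?invr_ge0 ?ler0n//; apply: sumr_ge0 => k _.
by rewrite ltW// lik_ratio_gt0.
Qed.

(** The squares are centred at the true mean [lam]. The competing positions of the block have true
    mean 0, so their ratios have mean 1 each, and there are at most [m] of them. *)
Let expect_noise j b :
  (joint_expect r (spike_vec j) (noise j b) <= (kap * (8 + 8 * r) + 1)%:E)%E.
Proof.
set i := block_index b (j b).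
have thi : tnth (spike_vec j) i = lam by rewrite tnth_spike_vec spikesE eqxx.
have mS : measurable_fun setT
    (fun z => \sum_(k < m | k != j b) lik_ratio (block_index b k) z).
  rewrite (_ : (fun z => _) = fun z => \sum_(k < m)
      (if k != j b then lik_ratio (block_index b k) z else 0)); last first.
    by apply/funext => z; rewrite big_mkcond.
  by apply: measurable_sum => k; case: (k != j b) => //; exact: measurable_lik_ratio.
have S0 z : 0 <= \sum_(k < m | k != j b) lik_ratio (block_index b k) z.
  by apply: sumr_ge0 => k _; rewrite ltW// lik_ratio_gt0.
have msq : measurable_fun setT (fun z : vec R n * vec R n =>
    (tnth z.1 i - lam) ^+ 2 + (tnth z.2 i - lam) ^+ 2 : R).
  apply: measurable_funD; apply: measurable_funX; apply: measurable_funB => //.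
    exact: (measurableT_comp (measurable_tnth _) measurable_fst).
  exact: (measurableT_comp (measurable_tnth _) measurable_snd).
have sq0 z : 0 <= (tnth z.1 i - lam) ^+ 2 + (tnth z.2 i - lam) ^+ 2 :> R.
  by rewrite addr_ge0// sqr_ge0.
have mi0 : 0 <= m%:R^-1 :> R by rewrite invr_ge0 ler0n.
rewrite /noise joint_expectD//; last 4 first.
- exact: measurable_funM.
- exact: measurable_funM.
- by move=> z; rewrite mulr_ge0.
- by move=> z; rewrite mulr_ge0.
rewrite !joint_expectZ// EFinD; apply: leeD.
  rewrite [leRHS]EFinM lee_wpmul2l ?lee_fin//.
  by have := joint_expect_sqr r0 (spike_vec j) i; rewrite thi.
rewrite joint_expect_sum//; last 2 first.
- by move=> k; exact: measurable_lik_ratio.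
- by move=> k z; rewrite ltW// lik_ratio_gt0.
rewrite (eq_bigr (fun=> 1%E)); last first.
  move=> k kj; apply: joint_expect_lik_ratio.
  by rewrite tnth_spike_vec spikesE (negbTE kj).
rewrite sumEFin -EFinM lee_fin ler_pdivrMl// mulr1.
by rewrite sumr_const ler_nat -[leqRHS]card_ord max_card.
Qed.

Let m_tilt j : measurable_fun setT (tilt j).
Proof.
have [mq _ _] := q_density.
apply: measurable_funM.
  apply: measurable_funM; last exact: measurable_posterior_ratio.
  apply: measurable_funM => //.
  exact: (measurableT_comp (measurable_gaussian_pdf _ _) measurable_fst).
apply: measurable_inv_pos; last by move=> z; rewrite mulr_gt0// gaussian_pdf_gt0.
apply: measurable_funM.
  exact: (measurableT_comp (measurable_gaussian_pdf _ _) measurable_fst).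
exact: (measurableT_comp (measurable_gaussian_pdf _ _) measurable_snd).
Qed.

Let tilt_ge0 j z : 0 <= tilt j z.
Proof.
have [_ q_ge0 _] := q_density.
rewrite divr_ge0 ?mulr_ge0 ?gaussian_pdf_ge0//.
by rewrite ltW// posterior_ratio_gt0.
Qed.

(** After exchanging sum and integral the posterior ratios sum to the constant [m ^ s], and [p0 q]
    is a probability density on pairs. *)
Let sum_expect_tilt :
  (\sum_(j : {ffun 'I_s -> 'I_m}) joint_expect r (spike_vec j) (tilt j) = (m ^ s)%:R%:E)%E.
Proof.
have [mq q_ge0 q1] := q_density.
have mp0 : measurable_fun setT (fun z : vec R n * vec R n => p0 z.1).
  exact: (measurableT_comp (measurable_gaussian_pdf _ _) measurable_fst).
have mpq : measurable_fun setT (fun z : vec R n * vec R n => p0 z.1 * q z.1 z.2).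
  exact: measurable_funM.
have pq0 z : 0 <= p0 z.1 * q z.1 z.2 by rewrite mulr_ge0// gaussian_pdf_ge0.
rewrite (eq_bigr (fun j => \int[lebesgue_vec R n \x lebesgue_vec R n]_z
    (p0 z.1 * q z.1 z.2 * posterior_ratio j z)%:E)%E); last first.
  move=> j _; apply: eq_integral => z _; congr EFin; rewrite /tilt mulrC divfK//.
  by rewrite gt_eqF// mulr_gt0// gaussian_pdf_gt0.
rewrite -ge0_integral_sum//; last 2 first.
- move=> j; apply/measurable_EFinP; apply: measurable_funM => //.
  exact: measurable_posterior_ratio.
- by move=> j z _; rewrite lee_fin mulr_ge0// ltW// posterior_ratio_gt0.
under eq_integral do rewrite sumEFin -mulr_sumr sum_posterior_ratio EFinM.
rewrite ge0_integralZr//; last 2 first.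
- exact/measurable_EFinP.
- by move=> z _; rewrite lee_fin.
rewrite fubini_tonelli1; last 2 first.
- exact/measurable_EFinP.
- by move=> z; rewrite lee_fin.
rewrite /fubini_F /=.
under eq_integral.
  move=> x _; under eq_integral do rewrite EFinM.
  rewrite ge0_integralZl//; last 3 first.
  - apply/measurable_EFinP; exact: (measurableT_comp mq (measurable_pair1 x)).
  - by move=> y _; rewrite lee_fin.
  - by rewrite lee_fin gaussian_pdf_ge0.
  rewrite q1 mule1; over.
by rewrite /p0 integral_gaussian// mul1e.
Qed.

(** There are [m ^ s] configurations and the expectations sum to [m ^ s]. The noise bound being
    uniform in [j], a single such configuration suffices for the worst-case risk. *)
Let exists_tilt_le1 : exists j, (joint_expect r (spike_vec j) (tilt j) <= 1)%E.
Proof.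
apply: contrapT => /forallNP h.
pose J j := joint_expect r (spike_vec j) (tilt j).
have J0 j : (0 <= J j)%E by exact: joint_expect_ge0.
have Jfin j : J j \is a fin_num.
  rewrite ge0_fin_numE//; apply: (@le_lt_trans _ _ (m ^ s)%:R%:E); last exact: ltry.
  rewrite -sum_expect_tilt (bigD1 j)//= leeDl//.
  by apply: sume_ge0 => ? _; exact: J0.
have : \sum_(j : {ffun 'I_s -> 'I_m}) (1 : R) < \sum_(j : {ffun 'I_s -> 'I_m}) fine (J j).
  pose j0 : {ffun 'I_s -> 'I_m} := [ffun=> Ordinal m0].
  have J1 j : 1 < fine (J j).
    by rewrite -lte_fin fineK// ltNge; apply/negP; exact: h.
  rewrite (bigD1 j0)//= [ltRHS](bigD1 j0)//=; apply: ltr_leD => //.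
  by apply: ler_sum => j _; exact: ltW.
rewrite (_ : \sum_j fine (J j) = (m ^ s)%:R); last first.
  apply: EFin_inj; rewrite -sumEFin -sum_expect_tilt.
  by apply: eq_bigr => j _; rewrite fineK.
by rewrite sumr_const card_ffun !card_ord ltxx.
Qed.

(** The [+ 1] of [loss_ge] pays for the tilt. Per block, the noise costs [kap * (8 + 8 * r) + 1],
    which joins the deterministic [kap]. *)
Lemma max_risk_ge (t : R) : lam <= t ->
  ((s%:R * (ln m%:R - ln 2 - 1 - lam ^+ 2 / 2 - kap * (9 + 8 * r)))%:E <=
   max_risk r (sparse_box n s t) q)%E.
Proof.
move=> lt; have [j hj] := exists_tilt_le1.
apply: (@le_trans _ _ (risk r (spike_vec j) q)); last first.
  by apply: ereal_sup_ubound; exists (spike_vec j) => //; exact: spike_vec_sparse.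
pose B z := \sum_(b < s) noise j b z + tilt j z.
apply: le_trans (risk_ge r0 (B := B) _ _ (loss_ge j)); last 2 first.
- by apply: measurable_funD => //; apply: measurable_sum => b; exact: m_noise.
- by move=> z; rewrite addr_ge0//; apply: sumr_ge0 => b _; exact: noise_ge0.
rewrite /B joint_expectD//; last 2 first.
- by apply: measurable_sum => b; exact: m_noise.
- by move=> z; apply: sumr_ge0 => b _; exact: noise_ge0.
rewrite joint_expect_sum//.
apply: (@le_trans _ _ ((s%:R * (ln m%:R - ln 2 - lam ^+ 2 / 2 - kap) + 1)%:E -
   (s%:R * (kap * (8 + 8 * r) + 1) + 1)%:E)%E).
  by rewrite -EFinB lee_fin le_eqVlt; apply/orP; left; apply/eqP; ring.
apply: leeB => //; rewrite EFinD; apply: leeD => //.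
rewrite -[X in X%:R](card_ord s) -sum1_card natr_sum mulr_suml -sumEFin.
by apply: lee_sum => b _; rewrite mul1r; exact: expect_noise.
Qed.

End lower_bound.

(** * The asymptotic equivalence *)

Lemma risk_bounds (R : realType) (n s : nat) (r t dl : R) (eta := s%:R / n%:R : R)
    (L := ln eta^-1) :
  0 < r -> 0 < dl <= 1 -> (0 < n)%N -> (1 <= s <= n)%N -> eta <= 2^-1 ->
  2 <= t -> Num.sqrt (2 * L) <= t ->
  exists a b : R, [/\
    max_risk r (sparse_box n s t) (spike_slab_predictive r eta t) = a%:E,
    minimax_risk r (sparse_box n s t) = b%:E,
    b <= a,
    a <= s%:R * (((1 + r)^-1 + 2 * dl) * L + ln t + (2 + loss_const r dl * (9 + 8 * r))) &
    s%:R * ((1 + r)^-1 * (L - ln 2) - ln 2 - 1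
      - (2 + r^-1) * Num.sqrt (2 * L) * (9 + 8 * r)) <= b].
Proof.
move=> r0 /andP[dl0 dl1] n0 /andP[s1 sn] eta_half t2 Lt.
have nR : 0 < n%:R :> R by rewrite ltr0n.
have sR : 0 < s%:R :> R by rewrite ltr0n.
have eta0 : 0 < eta by rewrite divr_gt0.
have r1 : 0 < 1 + r by lra.
set up := s%:R * _.
set lo := s%:R * _.
set M := max_risk _ _ _; set m := minimax_risk _ _.
have Mup : (M <= up%:E)%E.
  apply: ge_ereal_sup => _ [th hth <-].
  apply: le_trans (risk_spike_slab_le eta0 eta_half t2 r0 dl0 dl1 hth) _.
  rewrite lee_fin /up -/L le_eqVlt; apply/orP; left; apply/eqP.
  by rewrite mulrCA (_ : n%:R * eta = s%:R); [ring|rewrite /eta mulrC divfK// gt_eqF].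
have mM : (m <= M)%E.
  apply: ereal_inf_lbound; exists (spike_slab_predictive r eta t) => //.
  apply: bayes_predictive_density => //.
  exact: spike_slab_point_gt0.
have lom : (lo%:E <= m)%E.
  apply: le_ereal_inf_tmp => _ [q hq <-].
  (* The block length, positive since [s <= n]. Rounding costs at most [ln 2], because
     [n <= (k + 1) s <= 2 k s]. *)
  pose k := (n %/ s)%N.
  have k0 : (0 < k)%N by rewrite divn_gt0.
  have kR : 0 < k%:R :> R by rewrite ltr0n.
  have skn : (s * k <= n)%N by rewrite mulnC leq_trunc_div.
  have lnk0 : 0 <= ln k%:R :> R by rewrite ln_ge0// ler1n.
  have etaV : eta^-1 = n%:R / s%:R by rewrite /eta invf_div.
  have kL : ln k%:R <= L.
    rewrite /L etaV ler_ln ?posrE ?divr_gt0// ler_pdivlMr// -natrM ler_nat mulnC//.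
  have Lk : L - ln 2 <= ln k%:R.
    rewrite lerBlDl -lnM ?posrE// /L etaV ler_ln ?posrE ?divr_gt0 ?mulr_gt0//.
    rewrite ler_pdivrMr// -!natrM ler_nat.
    have := ltn_ceil n s1; rewrite -/k => h; apply: leq_trans (ltnW h) _.
    by rewrite leq_mul2r mul2n -addnn -[k.+1]addn1 leq_add2l k0 orbT.
  (* The solution of [lamE] for blocks of length [k]; it is at most [Num.sqrt (2 * L)], hence at
     most [t], so the spikes fit in the box. *)
  pose lam : R := Num.sqrt (2 * (r / (1 + r) * ln k%:R)).
  have v01 : 0 <= r / (1 + r) <= 1.
    apply/andP; split; first by apply: divr_ge0; lra.
    by rewrite ler_pdivrMr//; lra.
  have /andP[v0 v1] := v01.
  have lamsq : lam ^+ 2 = 2 * (r / (1 + r) * ln k%:R).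
    by rewrite sqr_sqrtr// mulr_ge0// mulr_ge0.
  have lamE : lam ^+ 2 / 2 * (1 + r^-1) = ln k%:R.
    by rewrite lamsq; field; rewrite !gt_eqF.
  have laml : lam <= Num.sqrt (2 * L).
    rewrite ler_wsqrtr// ler_pM2l//; apply: le_trans kL.
    by rewrite ler_piMl.
  apply: le_trans (max_risk_ge k0 skn r0 (sqrtr_ge0 _) lamE hq (le_trans laml Lt)).
  rewrite lee_fin /lo ler_pM2l//.
  have -> : ln k%:R - ln 2 - 1 - lam ^+ 2 / 2 = (1 + r)^-1 * ln k%:R - ln 2 - 1.
    by rewrite lamsq; field; rewrite gt_eqF.
  apply: lerB.
    by rewrite lerB// lerB// ler_pM2l// invr_gt0.
  rewrite ler_pM2r; last by lra.
  by rewrite ler_pM2l// addr_gt0// invr_gt0.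
have Mfin : M \is a fin_num.
  rewrite fin_numE -ltNye -ltey (le_lt_trans Mup) ?ltry// andbT.
  by rewrite (lt_le_trans (ltNyr lo))// (le_trans lom mM).
have mfin : m \is a fin_num.
  rewrite fin_numE -ltNye -ltey (le_lt_trans (le_trans mM Mup)) ?ltry// andbT.
  by rewrite (lt_le_trans (ltNyr lo)).
exists (fine M), (fine m); split; rewrite ?fineK//.
- by rewrite -lee_fin !fineK.
- by rewrite -lee_fin fineK.
- by rewrite -lee_fin fineK.
Qed.

Theorem theorem1p4 (R : realType) (r : R) (s : nat -> nat) (t : nat -> R)
    (eta := fun n => (s n)%:R / n%:R : R)
    (r_gt0 : 0 < r)
    (s_bounds : forall n, (0 < n)%N -> (1 <= s n <= n)%N)
    (t_gt0 : forall n, (0 < n)%N -> 0 < t n)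
    (eta_cvg : eta n @[n --> \oo] --> (0 : R))
    (t_large : t n / Num.sqrt (ln (eta n)^-1) @[n --> \oo] --> +oo)
    (t_small : ln (t n) / ln (eta n)^-1 @[n --> \oo] --> (0 : R)) :
  (max_risk r (sparse_box n (s n) (t n))
      (spike_slab_predictive r (eta n) (t n)) /
    minimax_risk r (sparse_box n (s n) (t n)))%E @[n --> \oo] --> 1%E.
Proof.
pose L n := ln (eta n)^-1.
have eta_gt0 n : (0 < n)%N -> 0 < eta n.
  by move=> n0; have /andP[s1 _] := s_bounds n n0; rewrite divr_gt0 ?ltr0n.
have eta_le (e : R) : 0 < e -> \forall n \near \oo, `|0 - eta n| <= e.
  by move=> e0; move/cvgrPdist_le : eta_cvg; apply.
have t_le (e : R) : 0 < e -> \forall n \near \oo, `|0 - ln (t n) / L n| <= e.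
  by move=> e0; move/cvgrPdist_le : t_small; apply.
have t_ge (A : R) : \forall n \near \oo, A <= t n / Num.sqrt (L n).
  by move/cvgryPge : t_large; apply.
have L_large (A : R) : \forall n \near \oo, A <= L n.
  near=> n.
  have n0 : (0 < n)%N by near: n; exact: nbhs_infty_gt.
  have e0 := eta_gt0 n n0.
  have : eta n <= expR (- A).
    have h : `|0 - eta n| <= expR (- A).
      by near: n; apply: eta_le; exact: expR_gt0.
    by move: h; rewrite sub0r normrN ger0_norm// ltW.
  rewrite -[X in X <= _](lnK (x := eta n)) ?posrE// ler_expR /L lnV ?posrE//; lra.
pose w := (1 + r)^-1.
have w0 : 0 < w by rewrite invr_gt0; lra.
(* With [W = s w L], the two values satisfy [(1 - ep) W <= b <= a <= (1 + ep) W]; for [ep <= 1/2]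
   one has [1 + ep <= (1 + 4 ep) (1 - ep)]. *)
have key (ep : R) : 0 < ep -> ep <= 2^-1 -> \forall n \near \oo,
  exists a b : R, [/\
    max_risk r (sparse_box n (s n) (t n)) (spike_slab_predictive r (eta n) (t n)) = a%:E,
    minimax_risk r (sparse_box n (s n) (t n)) = b%:E, 0 < b, b <= a &
    a <= (1 + 4 * ep) * b].
  move=> ep0 ep1.
  (* Error budget relative to [w L]: above, [ep / 4] each for [2 dl L], [ln t] and [C1]; below,
     [ep / 2] each for the [C2] and [C3] terms. *)
  pose dl := Num.min 1 (ep * w / 8).
  have dl0 : 0 < dl by rewrite lt_min ltr01 divr_gt0// mulr_gt0.
  have dl1 : dl <= 1 by rewrite ge_min lexx.
  have dlw : dl <= ep * w / 8 by rewrite ge_min lexx orbT.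
  pose C1 := 2 + loss_const r dl * (9 + 8 * r).
  pose C2 := (2 + r^-1) * (9 + 8 * r).
  pose C3 := w * ln 2 + ln 2 + 1.
  near=> n.
  have n0 : (0 < n)%N by near: n; exact: nbhs_infty_gt.
  have L1 : 1 <= L n by near: n; exact: L_large.
  have LC1 : 4 * C1 / (ep * w) <= L n by near: n; exact: L_large.
  (* Squared because [C2] multiplies the square root of [L]. *)
  have LC2 : (4 * C2 / (ep * w)) ^+ 2 <= L n by near: n; exact: L_large.
  have LC3 : 2 * C3 / (ep * w) <= L n by near: n; exact: L_large.
  (* Together with [1 <= L n], this yields both [2 <= t n] and [Num.sqrt (2 * L n) <= t n]. *)
  have tL : 2 <= t n / Num.sqrt (L n) by near: n; exact: t_ge.
  have lt : `|0 - ln (t n) / L n| <= ep * w / 4.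
    by near: n; apply: t_le; rewrite divr_gt0// mulr_gt0.
  have eh : eta n <= 2^-1.
    have h : `|0 - eta n| <= 2^-1.
      by near: n; apply: eta_le; rewrite invr_gt0.
    by move: h; rewrite sub0r normrN ger0_norm// ltW// eta_gt0.
  have L0 : 0 < L n by lra.
  have sqL1 : 1 <= Num.sqrt (L n) by rewrite -[leLHS]sqrtr1 ler_wsqrtr.
  have t2L : 2 * Num.sqrt (L n) <= t n by rewrite -ler_pdivlMr// sqrtr_gt0.
  have sq2L : Num.sqrt (2 * L n) <= 2 * Num.sqrt (L n).
    rewrite -[X in X * Num.sqrt _]ger0_norm// -sqrtr_sqr -sqrtrM ?sqr_ge0//.
    by rewrite ler_wsqrtr//; lra.
  have [a [b [Ma mb ba au bl]]] := risk_bounds (s := s n) (t := t n) r_gt0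
    (introT andP (conj dl0 dl1)) n0 (s_bounds n n0) eh ltac:(lra) (le_trans sq2L t2L).
  have epw : 0 < ep * w by rewrite mulr_gt0.
  have sR : 0 < (s n)%:R :> R by have /andP[s1 _] := s_bounds n n0; rewrite ltr0n.
  have wL : 0 < w * L n by rewrite mulr_gt0.
  have epwL : 0 < ep * (w * L n) by rewrite mulr_gt0.
  have C20 : 0 < C2 by rewrite mulr_gt0// ?addr_gt0// ?invr_gt0// mulr_gt0.
  have hC1 : C1 <= ep * (w * L n) / 4.
    by move: LC1; rewrite ler_pdivrMr//; lra.
  have hC3 : C3 <= ep * (w * L n) / 2.
    by move: LC3; rewrite ler_pdivrMr//; lra.
  have hC2 : C2 * Num.sqrt (2 * L n) <= ep * (w * L n) / 2.
    have h : 4 * C2 <= Num.sqrt (L n) * (ep * w).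
      have q0 : 0 <= 4 * C2 / (ep * w) by apply/ltW/divr_gt0 => //; exact: mulr_gt0.
      by rewrite -ler_pdivrMr// -[leLHS]ger0_norm// -sqrtr_sqr ler_wsqrtr.
    have h1 : C2 * Num.sqrt (2 * L n) <= C2 * (2 * Num.sqrt (L n)) by rewrite ler_wpM2l// ltW.
    have h2 : Num.sqrt (L n) * (4 * C2) <= Num.sqrt (L n) * (Num.sqrt (L n) * (ep * w)).
      by apply: ler_wpM2l => //; exact: sqrtr_ge0.
    have h3 : Num.sqrt (L n) * (Num.sqrt (L n) * (ep * w)) = ep * (w * L n).
      by rewrite mulrA -expr2 sqr_sqrtr ?(ltW L0)//; ring.
    by lra.
  have hdl : dl * L n <= ep * (w * L n) / 8.
    have : dl * L n <= ep * w / 8 * L n by rewrite ler_wpM2r// ltW.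
    by lra.
  have hlt : ln (t n) <= ep * (w * L n) / 4.
    move: lt; rewrite sub0r normrN => /(le_trans (ler_norm _)).
    by rewrite ler_pdivrMr//; lra.
  have W0 : 0 < (s n)%:R * (w * L n) by rewrite mulr_gt0.
  have aW : a <= (1 + ep) * ((s n)%:R * (w * L n)).
    apply: le_trans au _; rewrite mulrCA ler_pM2l// -/(L n) -/w -/C1.
    by lra.
  have bW : (1 - ep) * ((s n)%:R * (w * L n)) <= b.
    apply: le_trans bl; rewrite mulrCA ler_pM2l// -/(L n) -/w.
    have -> : (2 + r^-1) * Num.sqrt (2 * L n) * (9 + 8 * r) = C2 * Num.sqrt (2 * L n).
      by rewrite /C2; ring.
    by rewrite /C3 in hC3; lra.
  have b0 : 0 < b by apply: lt_le_trans bW; rewrite mulr_gt0//; lra.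
  exists a, b; split => //.
  apply: le_trans aW _.
  apply: (@le_trans _ _ ((1 + 4 * ep) * ((1 - ep) * ((s n)%:R * (w * L n))))).
    by rewrite [leRHS]mulrA ler_pM2r//; nra.
  by rewrite ler_pM2l//; lra.
have ratioE a b : 0 < b -> (a%:E / b%:E)%E = (a / b)%:E :> \bar R.
  by move=> b0; rewrite inver (gt_eqF b0) -EFinM.
(* Convergence of extended reals to 1: the quotient is eventually finite, for which [key] at [1/2]
   is enough, and its real value converges. *)
apply/fine_cvgP; split.
  have [N _ hN] := key 2^-1 ltac:(by rewrite invr_gt0) (lexx _).
  exists N => // n /hN [a [b [-> -> b0 _ _]]].
  by rewrite ratioE.
apply/cvgrPdist_le => e e0.
pose ep := Num.min 2^-1 (e / 4).
have ep0 : 0 < ep by rewrite lt_min invr_gt0 ltr0n divr_gt0.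
have ep1 : ep <= 2^-1 by rewrite ge_min lexx.
have epe : ep <= e / 4 by rewrite ge_min lexx orbT.
have [N _ hN] := key ep ep0 ep1.
exists N => // n /hN [a [b [aE bE b0 ba ab]]].
rewrite /= aE bE ratioE//=.
have h1 : 1 <= a / b by rewrite ler_pdivlMr// mul1r.
have h2 : a / b <= 1 + 4 * ep by rewrite ler_pdivrMr.
by rewrite distrC ger0_norm; lra.
Unshelve. all: by end_near. Qed.
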